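(* Let $X\subset Y$ be Hilbert spaces such that the embedding $X\subset Y$ is compact and $X$ is dense in $Y$. Let $\mathcal{A}\colon X\to X'$ be an elliptic, continuous and symmetric linear operator, and let $s\in(0,1)$. Set $$\mathcal{H}=\left\{u\colon[0,\infty)\to [X,Y]_{s}\ :\ \int_0^\infty\left[\langle u'(t),u'(t)\rangle_Y+\langle \mathcal{A}u(t),u(t)\rangle_Y\right]t^{1-2s}\,\mathrm{d}t<\infty\right\}.$$ Then the embedding $\mathcal{H}\subset Y$ is compact in the trace sense, i.e. the trace map $\mathcal{H}\to Y$, $u\mapsto u(0)$, is a compact operator.
   Context: $X'$ is the dual of $X$; since $X$ is dense in $Y$, one identifies $X\subset Y\subset X'$. The operator $\mathcal{A}$ is symmetric if $\langle\mathcal{A}u,v\rangle=\langle\mathcal{A}v,u\rangle$ for $u,v\in X$ (with complex conjugation on one side in the complex case), and elliptic if there is $c>0$ with $\langle\mathcal{A}u,u\rangle\ge c\|u\|_X^2$ for all $u\in X$. The expression $\langle\mathcal{A}u,u\rangle_Y$ denotes the duality pairing of $\mathcal{A}u\in X'$ with $u\in X$ (the extension of the inner product of $Y$). $[X,Y]_\theta$, $0<\theta<1$, denotes the complex interpolation space between $X$ and $Y$, with the convention that $[X,Y]_\theta$ approaches $X$ as $\theta\to0$ and $Y$ as $\theta\to1$. Functions $u\in\mathcal{H}$ are understood to satisfy $u\in L^1_{loc}((0,\infty);X)$ with weak derivative $u'\in L^1_{loc}((0,\infty);Y)$. The space $\mathcal{H}$ carries the norm $$\|u\|_{\mathcal{H}}=\left(\int_0^\infty\left[\langle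 u'(t),u'(t)\rangle_Y+\langle \mathcal{A}u(t),u(t)\rangle_Y\right]t^{1-2s}\,\mathrm{d}t\right)^{1/2},$$ and the trace of $u$ is $u(0)=\lim_{t\downarrow0}u(t)$ in $Y$. *)

(* Defs.v *)
From HB Require Import structures.
From mathcomp Require Import all_boot all_order all_algebra.
From mathcomp Require Import sesquilinear complex ring.
From mathcomp Require Import all_classical all_reals all_analysis.

Set Implicit Arguments.
Unset Strict Implicit.
Unset Printing Implicit Defensive.

Import Order.TTheory GRing.Theory Num.Theory.
Import numFieldNormedType.Exports.

Local Open Scope classical_set_scope.
Local Open Scope ring_scope.

Variant field_kind := RealField | ComplexField.

Definition scalar_field (R : realType) (k : field_kind) : numFieldType :=
  match k with
  | RealField => (R : numFieldType)
  | ComplexField => (R[i] : numFieldType)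
  end.

Definition conjs (R : realType) (k : field_kind) :
  scalar_field R k -> scalar_field R k :=
  match k with
  | RealField => idfun
  | ComplexField => @conjc R
  end.

Definition of_real (R : realType) (k : field_kind) : R -> scalar_field R k :=
  match k return R -> scalar_field R k with
  | RealField => fun x => x
  | ComplexField => fun x => Complex x 0
  end.

Definition re (R : realType) (k : field_kind) : scalar_field R k -> R :=
  match k return scalar_field R k -> R with
  | RealField => fun x => x
  | ComplexField => @complex.Re R
  end.

(* {dot _ for theta} is linear in the first and theta-semilinear in the second
   argument. *)
Record hilbert (K : numFieldType) (theta : K -> K) := Hilbert {
  hilbert_space :> completeNormedModType K ;
  inner : {dot hilbert_space for theta} ;
  sqr_norm_inner : forall x : hilbert_space, `|x| ^+ 2 = inner x x
}.

Notation hilbertType R k := (@hilbert (scalar_field R k) (@conjs R k)).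

(* The library's norm takes its values in the scalar field. *)
Definition nrm (R : realType) (k : field_kind)
  (V : normedModType (scalar_field R k)) (x : V) : R := re `|x|.

Section complexification.
Variables (R : realType) (X : hilbert (@idfun R)).

Definition complexify : Type := (X * X)%type.

HB.instance Definition _ := GRing.Zmodule.copy complexify (X * X)%type.

Definition complexify_scale (z : R[i]) (x : complexify) : complexify :=
  (complex.Re z *: x.1 - complex.Im z *: x.2, complex.Re z *: x.2 + complex.Im z *: x.1).

Lemma complexify_scaleA a b v :
  complexify_scale a (complexify_scale b v) = complexify_scale (a * b) v.
Proof.
case: a b v => [a a'] [b b'] [x y]; rewrite /complexify_scale /=.
rewrite !(scalerDr, scalerN, scalerA, scalerBl, scalerDl, opprD, opprK).
by congr pair; rewrite [RHS]addrACA; congr (_ + _); rewrite addrC.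
Qed.

Lemma complexify_scale1 : left_id 1 complexify_scale.
Proof.
by case=> x y; rewrite /complexify_scale /= !scale1r !scale0r subr0 addr0.
Qed.

Lemma complexify_scaleDr : right_distributive complexify_scale +%R.
Proof.
case=> a b [x y] [x' y']; rewrite /complexify_scale /=.
by congr pair; rewrite /= !scalerDr ?opprD addrACA.
Qed.

Lemma complexify_scaleDl v :
  {morph complexify_scale^~ v : a b / a + b}.
Proof.
case: v => x y [a a'] [b b']; rewrite /complexify_scale /=.
by congr pair; rewrite /= !scalerDl ?opprD addrACA.
Qed.

HB.instance Definition _ := GRing.Zmodule_isLmodule.Build R[i] complexify
  complexify_scaleA complexify_scale1 complexify_scaleDr complexify_scaleDl.

Definition complexify_norm (x : complexify) : R[i] :=
  Complex (Num.sqrt (`|x.1| ^+ 2 + `|x.2| ^+ 2)) 0.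

Let complexify_normE x : complexify_norm x = `|Complex `|x.1| `|x.2| |.
Proof. by []. Qed.

Lemma complexify_ler_normD x y :
  complexify_norm (x + y) <= complexify_norm x + complexify_norm y.
Proof.
rewrite !complexify_normE; apply: le_trans (ler_normD _ _).
rewrite -!complexify_normE /complexify_norm lecE /= eqxx /=.
by rewrite ler_wsqrtr // lerD // ler_sqr ?nnegrE ?addr_ge0 // ler_normD.
Qed.

Let sqr_norm_lin (a b : R) (x y : X) :
  `|a *: x + b *: y| ^+ 2 =
  a ^+ 2 * `|x| ^+ 2 + a * b * inner X x y *+ 2 + b ^+ 2 * `|y| ^+ 2.
Proof.
rewrite !sqr_norm_inner linearDl !linearDr /= !linearZl_LR !linearZr_LR /=.
have -> : inner X y x = inner X x y.
  by have := hermC (inner X) y x; rewrite expr0 mul1r => ->.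
have scE (c d : R) : c *: (d : R^o) = c * d by [].
rewrite !scE; ring.
Qed.

Lemma complexify_normrZ (z : R[i]) x :
  complexify_norm (z *: x) = `|z| * complexify_norm x.
Proof.
case: z x => a b [x y].
have -> : Complex a b *: ((x, y) : complexify) =
  (a *: x - b *: y, a *: y + b *: x) by [].
rewrite /complexify_norm normc_def /= -[RHS]rmorphM; congr (Complex _ 0).
rewrite -sqrtrM ?addr_ge0 ?sqr_ge0 //; congr Num.sqrt.
rewrite -scaleNr !sqr_norm_lin.
have -> : inner X y x = inner X x y.
  by have := hermC (inner X) y x; rewrite expr0 mul1r => ->.
ring.
Qed.

Lemma complexify_normr0_eq0 x : complexify_norm x = 0 -> x = 0.
Proof.
case: x => x y [] /eqP; rewrite sqrtr_eq0 /= => le0.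
have /eqP : `|x| ^+ 2 + `|y| ^+ 2 = 0.
  by apply/eqP; rewrite eq_le le0 addr_ge0 ?sqr_ge0.
rewrite paddr_eq0 ?sqr_ge0 // !sqrf_eq0 !normr_eq0.
by case/andP => /eqP -> /eqP ->.
Qed.

HB.instance Definition _ := Lmodule_isNormed.Build R[i] complexify
  complexify_ler_normD complexify_normrZ complexify_normr0_eq0.

End complexification.

Section complex_interpolation.
Variables (R : realType) (X Y : normedModType R[i]) (j : X -> Y).

Definition strip : set R[i]^o := [set z | 0 <= complex.Re z <= 1].
Definition open_strip : set R[i]^o := [set z | 0 < complex.Re z < 1].

(* Calderon's class of functions for the couple (X, Y); since X embeds
   continuously in Y, the sum space X + Y is Y. The boundary values on the line
   Re z = 0 are continuous into X and g is this X-valued boundary function. *)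
Definition calderon (f : R[i]^o -> Y) :=
  [/\ {within strip, continuous f},
      (exists M : R, forall z, strip z -> `|f z| <= Complex M 0),
      (forall z, open_strip z -> derivable f z 1),
      (exists g : R -> X, [/\ forall t, f (Complex 0 t) = j (g t),
        continuous g, g t @[t --> +oo] --> 0 & g t @[t --> -oo] --> 0]) &
      [/\ continuous (fun t : R => f (Complex 1 t)),
        f (Complex 1 t) @[t --> +oo] --> 0 &
        f (Complex 1 t) @[t --> -oo] --> 0]].

Definition complex_interpolation (theta : R) : set Y :=
  [set y | exists2 f, calderon f & f (Complex theta 0) = y].

End complex_interpolation.

(* For real spaces, the real part of the interpolation space of the
   complexified couple. *)
Definition interpolation (R : realType) (k : field_kind) :
  forall X Y : hilbertType R k, (X -> Y) -> R -> set Y :=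
  match k return forall X Y : hilbertType R k, (X -> Y) -> R -> set Y with
  | RealField => fun X Y j theta =>
      [set y | @complex_interpolation R (complexify X) (complexify Y)
                 (fun x => (j x.1, j x.2)) theta (y, 0)]
  | ComplexField => fun X Y j theta =>
      @complex_interpolation R X Y j theta
  end.

Section vector_valued.
Variables (R : realType) (k : field_kind).
Variable V : normedModType (scalar_field R k).
Let mu := @lebesgue_measure R.
Implicit Types (D : set R) (f s : R -> V).

Definition simple s :=
  finite_set (range s) /\
  forall v, measurable (s @^-1` [set v] : set (measurableTypeR R)).

Definition strongly_measurable D f :=
  exists s : nat -> R -> V, (forall n, simple (s n)) /\
    {ae mu, forall t, D t -> s n t @[n --> \oo] --> f t}.

Definition L1norm D f : \bar R := (\int[mu]_(t in D) (nrm (f t))%:E)%E.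

Definition simple_integral D s : V :=
  \sum_(v \in range s) of_real k (fine (mu (D `&` s @^-1` [set v]))) *: v.

(* [I] is the Bochner integral of [f] over [D]. *)
Definition is_bochner_integral D f (I : V) :=
  strongly_measurable D f /\
  exists s : nat -> R -> V,
    [/\ forall n, simple (s n) /\ (L1norm D (s n) < +oo)%E,
        L1norm D (f \- s n) @[n --> \oo] --> 0%E &
        simple_integral D (s n) @[n --> \oo] --> I].

Definition L1loc f :=
  strongly_measurable `]0, +oo[ f /\
  forall a b : R, 0 < a -> a < b -> (L1norm `[a, b] f < +oo)%E.

Definition test_function (phi : R -> R) :=
  (forall n t, derivable (derive1n n phi) t 1) /\
  exists a b : R, 0 < a /\ forall t, ~ (a <= t <= b) -> phi t = 0.

(* [v] is the weak derivative of [u] on (0, +oo). *)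
Definition is_weak_derivative (u v : R -> V) :=
  L1loc v /\
  forall phi, test_function phi -> exists I,
    is_bochner_integral `]0, +oo[ (fun t => of_real k (derive1 phi t) *: u t) I /\
    is_bochner_integral `]0, +oo[ (fun t => of_real k (phi t) *: v t) (- I).

Definition weak_derivative (u : R -> V) : R -> V :=
  xget (fun=> 0) [set v | is_weak_derivative u v].

(* Functions are identified when they agree almost everywhere, so the limit at 0
   is that of the representative that is continuous in V. *)
Definition is_trace (u : R -> V) (y : V) :=
  exists v : R -> V,
    [/\ {ae mu, forall t, 0 < t -> u t = v t},
        {in `]0, +oo[, continuous v} &
        v t @[t --> 0^'+] --> y].

Definition trace (u : R -> V) : V := xget 0 [set y | is_trace u y].

End vector_valued.

(* A linear map defined on D that sends subsets of D bounded for the (semi)norm N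
   to relatively compact sets. *)
Definition compact_operator (K : numFieldType) (R : realType) (E : lmodType K)
  (W : normedModType K) (D : set E) (N : E -> R) (T : E -> W) :=
  (forall a x y, D x -> D y -> T (a *: x + y) = a *: T x + T y) /\
  forall B, B `<=` D -> (exists M, forall x, B x -> N x <= M) ->
    compact (closure (T @` B)).

Section dual.
Variables (R : realType) (k : field_kind) (X : hilbertType R k).
Local Notation K := (scalar_field R k).

(* The (anti)dual X': functionals are semilinear for the conjugation, so that
   y |-> <y, _> embeds Y in X' linearly. *)
Definition dual_space : set (X -> K^o) :=
  [set f | GRing.linear_for (conjs (k := k) \; *%R) f /\ continuous f].

Definition dual_norm (f : X -> K^o) : R :=
  sup [set nrm (f v) | v in [set v : X | nrm v <= 1]].

Definition dual_continuous (A : X -> X -> K^o) :=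
  forall u, dual_norm (A v - A u) @[v --> u] --> (0 : R).

Definition symmetric_operator (A : X -> X -> K^o) :=
  forall u v, A u v = conjs (A v u).

Definition elliptic (A : X -> X -> K^o) :=
  exists2 c : R, 0 < c & forall u, of_real k c * `|u| ^+ 2 <= A u u.

End dual.

Section trace_space.
Variables (R : realType) (k : field_kind) (X Y : hilbertType R k).
Variables (j : X -> Y) (A : X -> X -> scalar_field R k) (s : R).
Let mu := @lebesgue_measure R.

(* For u in the range of j almost everywhere, u seen as an X-valued function. *)
Definition pull (u : R -> Y) (t : R) : X := xget 0 [set x | j x = u t].

Definition energy (u : R -> Y) : \bar R :=
  (\int[mu]_(t in `]0%R, +oo[)
    (re (inner Y (weak_derivative u t) (weak_derivative u t)
         + A (pull u t) (pull u t)) * t `^ (1 - 2 * s))%:E)%E.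

Definition Hspace : set (R -> Y) := [set u |
  [/\ forall t, 0 <= t -> interpolation j s (u t),
      {ae mu, forall t, 0 < t -> range j (u t)} /\ L1loc (pull u),
      exists v, is_weak_derivative u v &
      (energy u < +oo)%E]].

Definition Hnorm (u : R -> Y) : R := Num.sqrt (fine (energy u)).

End trace_space.

(* Main.v *)
(* For u in H, the weak derivative makes u almost everywhere equal to a
   continuous function, and Cauchy-Schwarz with the weight t^(1-2s) gives
   |u(t) - u(r)|^2 <= E (t^(2s) - r^(2s)) / (2s), E being the energy of u; since
   s > 0, the limit u(0) exists and |u(0) - u(t)|^2 <= E t^(2s) / (2s). On the
   other hand the part of the energy carried by A forces some t in (e/2, e) at
   which |u(t)|_X is bounded by a constant depending only on E, e and the
   ellipticity constant. Hence the traces of a bounded part of H lie within an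
   arbitrarily small distance of the image under j of a ball of X, which is
   relatively compact, so they form a relatively compact set.

   The a.e. increment bound needs no vector-valued differentiation theorem: u and
   its weak derivative are a.e. limits of simple functions, so it suffices to test
   them against the countably many differences of values of these simple
   functions, and each of the resulting real functions is treated at its
   Lebesgue points with smooth approximations of the indicator of [r, t]. *)

Require Import Defs.
From mathcomp Require Import all_boot all_order all_algebra.
From mathcomp Require Import complex finmap ring lra.
From mathcomp Require Import all_classical all_reals all_analysis measurable_realfun.

Import Order.TTheory GRing.Theory Num.Theory.
Import numFieldNormedType.Exports.

Set Implicit Arguments.
Unset Strict Implicit.
Unset Printing Implicit Defensive.

Local Open Scope classical_set_scope.
Local Open Scope ring_scope.

(** * Real scalars, norms and inner products over the real or complex field *)

Section scalars.
Context {R : realType} {k : field_kind}.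
Local Notation K := (scalar_field R k).
Implicit Types (a b : K) (c : R).

Lemma re0 : re (0 : K) = 0. Proof. by case: k. Qed.

Lemma reD a b : re (a + b) = re a + re b.
Proof. by case: k a b => //= -[? ?] [? ?]. Qed.

Lemma reN a : re (- a) = - re a.
Proof. by case: k a => //= -[? ?]. Qed.

Lemma of_real0 : of_real k (0 : R) = 0. Proof. by case: k. Qed.

Lemma re_of_realM c a : re (of_real k c * a) = c * re a.
Proof. by case: k a => //= -[x y] /=; rewrite mul0r subr0. Qed.

Lemma of_real_re a : 0 <= a -> of_real k (re a) = a.
Proof. by case: k a => //= -[x y]; rewrite lecE /= => /andP[/eqP ->]. Qed.

Lemma lt_of_real c d : (of_real k c < of_real k d) = (c < d).
Proof. by case: k => //=; rewrite ltcE /= eqxx. Qed.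

Lemma le_re a b : a <= b -> re a <= re b.
Proof. by case: k a b => //= -[x y] [x' y']; rewrite lecE /= => /andP[]. Qed.

Lemma of_real_gt0 c : (0 < of_real k c) = (0 < c).
Proof. by rewrite -(of_real0) lt_of_real. Qed.

Lemma re_gt0 a : 0 < a -> 0 < re a.
Proof. by move=> a0; rewrite -of_real_gt0 of_real_re // ltW. Qed.

Lemma norm_of_real c : `|of_real k c| = of_real k `|c|.
Proof. by case: k => //; rewrite /= normc_def /= expr0n addr0 sqrtr_sqr. Qed.

Lemma re_conjs a : re (conjs a) = re a.
Proof. by case: k a => // -[]. Qed.

Lemma re_sqr a : 0 <= a -> re (a ^+ 2) = (re a) ^+ 2.
Proof. by move=> a0; rewrite !expr2 -{1}(of_real_re a0) re_of_realM. Qed.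

End scalars.

Section norm.
Context {R : realType} {k : field_kind} {V : normedModType (scalar_field R k)}.
Implicit Types (x y : V) (c : R).

Lemma of_real_nrm x : of_real k (nrm x) = `|x|.
Proof. by rewrite of_real_re. Qed.

Lemma nrm_ge0 x : 0 <= nrm x.
Proof. by rewrite -(re0 (k := k)); exact: le_re. Qed.

Lemma nrm0 : nrm (0 : V) = 0. Proof. by rewrite /nrm normr0 re0. Qed.

Lemma nrm_eq0 x : (nrm x == 0) = (x == 0).
Proof.
apply/eqP/eqP => [x0|->]; last exact: nrm0.
by apply/normr0_eq0; rewrite -of_real_nrm x0 of_real0.
Qed.

Lemma nrmD x y : nrm (x + y) <= nrm x + nrm y.
Proof. by rewrite -reD; apply/le_re/ler_normD. Qed.

Lemma nrmN x : nrm (- x) = nrm x. Proof. by rewrite /nrm normrN. Qed.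

Lemma nrm_distC x y : nrm (x - y) = nrm (y - x).
Proof. by rewrite -nrmN opprB. Qed.

Lemma nrm_triangle z x y : nrm (x - y) <= nrm (x - z) + nrm (z - y).
Proof. by have := nrmD (x - z) (z - y); rewrite addrA subrK. Qed.

Lemma ler_dist_nrm x y : `|nrm x - nrm y| <= nrm (x - y).
Proof.
have h (a b : V) : nrm a - nrm b <= nrm (a - b).
  by rewrite lerBlDr; have := nrmD (a - b) b; rewrite subrK.
by rewrite ler_norml h andbT lerNl opprB nrm_distC h.
Qed.

Lemma nrmZ_of_real c x : nrm (of_real k c *: x) = `|c| * nrm x.
Proof. by rewrite /nrm normrZ norm_of_real re_of_realM. Qed.

Lemma cvg_nrmP {T : Type} (F : set_system T) {FF : Filter F} (f : T -> V) x :
  f @ F --> x <-> forall e : R, 0 < e -> \forall t \near F, nrm (x - f t) < e.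
Proof.
split => [/cvgrPdist_lt fx e e0|fx].
  have := fx (of_real k e); rewrite of_real_gt0 => /(_ e0).
  by apply: filterS => t; rewrite -of_real_nrm lt_of_real.
apply/cvgrPdist_lt => e e0; rewrite -[e]of_real_re ?ltW //.
by apply: filterS (fx _ (re_gt0 e0)) => t; rewrite -of_real_nrm lt_of_real.
Qed.

Lemma cvg_nrm {T : Type} (F : set_system T) {FF : Filter F} (f : T -> V) x :
  f @ F --> x -> nrm (f t) @[t --> F] --> nrm x.
Proof.
move=> /cvg_nrmP fx; apply/cvgrPdist_lt => e e0.
apply: filterS (fx _ e0) => t; apply: le_lt_trans; exact: ler_dist_nrm.
Qed.

Lemma nbhs_nrmP x (A : set V) :
  nbhs x A <-> exists2 e : R, 0 < e & [set y | nrm (x - y) < e] `<=` A.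
Proof.
split => [xA|[e e0 eA]].
  have [e /= e0 eA] := (@nbhs_ballP (scalar_field R k) V x A).1 xA.
  exists (re e); first exact: re_gt0.
  move=> y /= xy; apply: eA; rewrite -ball_normE /ball_ /=.
  by rewrite -of_real_nrm -[e]of_real_re ?ltW // lt_of_real.
apply/(@nbhs_ballP (scalar_field R k)); exists (of_real k e) => /=.
  by rewrite of_real_gt0.
move=> y; rewrite -ball_normE /ball_ /= -of_real_nrm lt_of_real; exact: eA.
Qed.

End norm.

Section inner.
Context {R : realType} {k : field_kind} {V : hilbertType R k}.
Implicit Types (x y z : V) (c : R).

(** Taking real parts makes [V] a real inner product space with the same norm, so both scalar fields
    are handled together and pairing with a fixed vector yields real functions. *)
Definition rip x y : R := re (inner V x y).

Lemma ripDl x y z : rip (x + y) z = rip x z + rip y z.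
Proof. by rewrite /rip linearDl reD. Qed.

Lemma ripNl x z : rip (- x) z = - rip x z.
Proof. by rewrite /rip linearNl reN. Qed.

Lemma ripBl x y z : rip (x - y) z = rip x z - rip y z.
Proof. by rewrite ripDl ripNl. Qed.

Lemma rip0l z : rip 0 z = 0.
Proof. by rewrite /rip linear0l re0. Qed.

Lemma ripZl c x z : rip (of_real k c *: x) z = c * rip x z.
Proof. by rewrite /rip linearZl_LR /= re_of_realM. Qed.

Lemma ripC x y : rip x y = rip y x.
Proof.
rewrite /rip; case: (inner V) => op [? ? [herm]] /=.
by have := herm x y; rewrite expr0 mul1r => ->; rewrite re_conjs.
Qed.

Lemma ripBr x y z : rip z (x - y) = rip z x - rip z y.
Proof. by rewrite ripC ripBl !(ripC _ z). Qed.

Lemma ripZr c x z : rip z (of_real k c *: x) = c * rip z x.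
Proof. by rewrite ripC ripZl ripC. Qed.

Lemma rip_nrm x : rip x x = nrm x ^+ 2.
Proof. by rewrite /rip -sqr_norm_inner re_sqr. Qed.

Lemma rip_sum I (r : seq I) (F : I -> V) z :
  rip (\sum_(i <- r) F i) z = \sum_(i <- r) rip (F i) z.
Proof. exact: (big_morph (rip^~ z) (fun x y => ripDl x y z) (rip0l z)). Qed.

Lemma le_rip x y : `|rip x y| <= nrm x * nrm y.
Proof.
have key (a b : V) : rip a b <= nrm a * nrm b.
  have [->|a0] := eqVneq a 0; first by rewrite rip0l nrm0 mul0r.
  have [->|b0] := eqVneq b 0; first by rewrite ripC rip0l nrm0 mulr0.
  have pa : 0 < nrm a by rewrite lt_def nrm_eq0 a0 nrm_ge0.
  have pb : 0 < nrm b by rewrite lt_def nrm_eq0 b0 nrm_ge0.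
  (* Cauchy-Schwarz: expand the square of the norm of |b| a - |a| b and divide by |a| |b| > 0. *)
  have := sqr_ge0 (nrm (of_real k (nrm b) *: a - of_real k (nrm a) *: b)).
  rewrite -rip_nrm !(ripBl, ripBr, ripZl, ripZr) !rip_nrm (ripC b a) => h.
  rewrite -(ler_pM2l (mulr_gt0 pa pb)); nra.
by rewrite ler_norml key andbT lerNl -ripNl (le_trans (key _ _)) // nrmN.
Qed.

End inner.

(** * Smooth step functions *)

Section bump.
Context {R : realType}.
Implicit Types (p : {poly R}) (m : nat) (x : R).

(** For p = 1 and m = 0 this is the classical bump exp(-1/(x(1-x))) on (0, 1). The factors p and
    (x(1-x))^-m make the family stable under differentiation, so smoothness follows from one
    derivative. *)
Definition bump_of p m x : R :=
  if 0 < x < 1 then p.[x] * (x * (1 - x))^-1 ^+ m * expR (- (x * (1 - x))^-1)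
  else 0.

Lemma horner_unit_bound p x : 0 <= x <= 1 -> `|p.[x]| <= \sum_(i < size p) `|p`_i|.
Proof.
move=> /andP[x0 x1]; rewrite horner_coef; apply: le_trans (ler_norm_sum _ _ _) _.
apply: ler_sum => i _; rewrite normrM ler_piMr // normrX ger0_norm //.
exact: exprn_ile1.
Qed.

(** For m > 0, raise x/m <= 1 + x/m <= exp(x/m) to the power m. *)
Lemma exprn_le_expR m x : 0 <= x -> x ^+ m <= m%:R ^+ m * expR x.
Proof.
case: m => [|m] x0; first by rewrite !expr0 mul1r; rewrite -expR0 ler_expR.
have m0 : 0 < m.+1%:R :> R by rewrite ltr0n.
have -> : expR x = expR (x / m.+1%:R) ^+ m.+1.
  by rewrite -expRM_natl mulrCA divff ?mulr1 // gt_eqF.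
rewrite -exprMn; apply: lerXn2r; rewrite ?nnegrE ?mulr_ge0 ?expR_ge0 //.
rewrite mulrC -ler_pdivrMr //.
by apply: le_trans (expR_ge1Dx _); rewrite lerDr.
Qed.

(** With y = 1/(x(1-x)), the exponential exp(-y) absorbs y^(m+2). The two spare powers give the
    quadratic decay that makes the function differentiable at 0 and 1. *)
Lemma bump_of_le p m :
  exists2 C : R, 0 <= C & forall x, 0 < x < 1 -> `|bump_of p m x| <= C * (x * (1 - x)) ^+ 2.
Proof.
have [M M0 hM] : exists2 M : R, 0 <= M & forall y, 0 <= y -> y ^+ m.+2 <= M * expR y.
  by exists (m.+2%:R ^+ m.+2) => [|y]; [exact: exprn_ge0|exact: exprn_le_expR].
exists ((\sum_(i < size p) `|p`_i|) * M); first by rewrite mulr_ge0 ?sumr_ge0.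
move=> x x01; rewrite /bump_of x01; have /andP[x0 x1] := x01.
set q := x * (1 - x); have q0 : 0 < q by rewrite mulr_gt0 // subr_gt0.
rewrite !normrM -!mulrA ler_pM ?mulr_ge0 //.
  by apply: horner_unit_bound; rewrite !ltW.
rewrite (ger0_norm (expR_ge0 _)) normrX ger0_norm ?invr_ge0 ?(ltW q0) //.
rewrite expRN ler_pdivrMr ?expR_gt0 // mulrAC.
have -> : q^-1 ^+ m = q^-1 ^+ m.+2 * q ^+ 2.
  by rewrite -addn2 exprD -mulrA -exprMn mulVf ?expr1n ?mulr1 // gt_eqF.
by rewrite ler_wpM2r ?exprn_ge0 ?hM ?invr_ge0 // ltW.
Qed.

Lemma bump_of_out p m x : ~~ (0 < x < 1) -> bump_of p m x = 0.
Proof. by rewrite /bump_of => /negbTE ->. Qed.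

(* With q = x (1 - x), the derivative of p q^-m exp(-1/q) is
   (p' q^2 - m p q' q + p q') q^-(m+2) exp(-1/q). *)
Definition bump_deriv p m : {poly R} :=
  p^`() * ('X * (1 - 'X)) ^+ 2 - m%:R *: (p * (1 - 'X *+ 2) * ('X * (1 - 'X)))
  + p * (1 - 'X *+ 2).

Lemma horner_bump_deriv p m x : (bump_deriv p m).[x] =
  p^`().[x] * (x * (1 - x)) ^+ 2 - m%:R * (p.[x] * (1 - x *+ 2) * (x * (1 - x)))
  + p.[x] * (1 - x *+ 2).
Proof. by rewrite /bump_deriv !hornerE; ring. Qed.

Lemma is_derive_bump_of p m x :
  is_derive x 1 (bump_of p m) (bump_of (bump_deriv p m) (m + 2) x).
Proof.
have [x01|x01] := boolP (0 < x < 1).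
  have /andP[x0 x1] := x01.
  have q0 : x * (1 - x) != 0 by rewrite mulf_neq0 ?gt_eqF // subr_gt0.
  pose q (y : R) := y * (1 - y).
  have dq : is_derive x 1 q (1 - x *+ 2).
    apply: is_derive_eq; rewrite /GRing.scale /=; ring.
  have dV : is_derive x 1 (fun y => (q y)^-1) (- (q x) ^- 2 * (1 - x *+ 2)).
    exact: is_deriveV.
  have dX : is_derive x 1 (fun y => (q y)^-1 ^+ m)
      (m%:R * (q x)^-1 ^+ m * - (q x)^-1 * (1 - x *+ 2)).
    have -> : (fun y => (q y)^-1 ^+ m) = (fun y => (q y)^-1) ^+ m.
      by apply/funext => y; rewrite fctE.
    apply: is_derive_eq (is_deriveX m dV) _; rewrite /GRing.scale /=.
    case: m => [|n]; first by rewrite !mul0r.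
    have -> : (q x) ^- 2 = (q x)^-1 * (q x)^-1 by rewrite expr2 invfM.
    by rewrite exprS -pred_Sn; ring.
  have dE : is_derive x 1 (fun y => expR (- (q y)^-1))
      (expR (- (q x)^-1) * ((q x) ^- 2 * (1 - x *+ 2))).
    have dN : is_derive x 1 (fun y => - (q y)^-1) ((q x) ^- 2 * (1 - x *+ 2)).
      by apply: is_derive_eq; rewrite mulNr opprK.
    exact: (is_derive1_comp (f := expR)).
  have dF : is_derive x 1 ((horner p) * ((fun y => (q y)^-1 ^+ m) *
       (fun y => expR (- (q y)^-1)))) (bump_of (bump_deriv p m) (m + 2) x).
    apply: is_derive_eq; rewrite /bump_of x01 horner_bump_deriv -/(q x).
    have -> : ((fun y => (q y)^-1 ^+ m) * (fun y => expR (- (q y)^-1))) x =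
      (q x)^-1 ^+ m * expR (- (q x)^-1) by [].
    rewrite exprD /GRing.scale /=. 
    move: (q x) (q0 : q x != 0) => Q Q0; move: (Q^-1 ^+ m) (expR _) => V E.
    by field.
  apply: near_eq_is_derive dF.
  have : \forall y \near x, 0 < y < 1.
    by apply: filterS (near_in_itvoo x01).
  by apply: filterS => y y01; rewrite /bump_of y01 -mulrA.
rewrite (bump_of_out _ _ x01).
(* Outside (0, 1), endpoints included, the value at x is 0. If x + h lies in (0, 1), then q =
   (x+h)(1-(x+h)) is at most |h|, so the difference quotient is bounded by C q^2 / |h| <= C |h|. *)
have [C C0 hC] := bump_of_le p m.
have cvg0 : h^-1 *: (bump_of p m (h *: 1 + x) - bump_of p m x) @[h --> 0^'] --> (0 : R).
  rewrite (bump_of_out _ _ x01).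
  apply/cvgrPdist_le => e e0.
  exists (e / (C + 1)) => /=; first by rewrite divr_gt0 // ltr_pwDr.
  move=> h /=; rewrite sub0r normrN ltr_pdivlMr ?ltr_pwDr // => he h0.
  rewrite sub0r normrN subr0 /GRing.scale /= mulr1 normrM normfV.
  rewrite ler_pdivrMl ?normr_gt0 // mulrC.
  have [hx|hx] := boolP (0 < h + x < 1); last first.
    by rewrite bump_of_out // normr0 mulr_ge0 // ltW.
  apply: le_trans (hC _ hx) _.
  have /andP[hx0 hx1] := hx.
  have qh : (h + x) * (1 - (h + x)) <= `|h|.
    have h1 := sqr_ge0 (h + x); have h2 := sqr_ge0 (1 - (h + x)).
    move: x01; rewrite negb_and -!leNgt => /orP[x0|x1].
      apply: le_trans _ (ler_norm _); nra.
    by rewrite -normrN; apply: le_trans _ (ler_norm _); nra.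
  have q0 : 0 <= (h + x) * (1 - (h + x)) by rewrite mulr_ge0 // ?subr_ge0 ltW.
  apply: (@le_trans _ _ (C * `|h| ^+ 2)).
    by rewrite ler_wpM2l // lerXn2r // nnegrE.
  by rewrite expr2 mulrA ler_wpM2r //; have := normr_ge0 h; nra.
split; first by apply/cvg_ex; exists 0.
exact: cvg_lim.
Qed.
End bump.

(** * Calculus of smooth functions and a smooth step from 0 to 1 *)

Section smooth.
Context {R : realType}.
Implicit Types (f g : R -> R) (p : {poly R}).
Local Notation mu := (@lebesgue_measure R).

Definition smooth f := forall n x, derivable (derive1n n f) x 1.

Lemma derive1n_bump_of n p m :
  exists p' m', derive1n n (bump_of p m) = bump_of p' m'.
Proof.
elim: n => [|n [p' [m' IH]]]; first by exists p, m.
exists (bump_deriv p' m'), (m' + 2)%N.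
rewrite derive1nS IH; apply/funext => x.
by have [_ <-] := is_derive_bump_of p' m' x; rewrite derive1E.
Qed.

Lemma smooth_bump_of p m : smooth (bump_of p m).
Proof.
move=> n x; have [p' [m' ->]] := derive1n_bump_of n p m.
by have [] := is_derive_bump_of p' m' x.
Qed.

Lemma derive1n_affine f (a b c : R) n : smooth f ->
  derive1n n (fun x => c * f (a * x + b)) =
  (fun x => c * a ^+ n * derive1n n f (a * x + b)).
Proof.
move=> sf; elim: n => [|n IH]; first by rewrite !derive1n0 expr0 mulr1.
rewrite !derive1nS IH; apply/funext => x; rewrite derive1E.
have da : is_derive x 1 (fun y : R => a * y + b) a.
  by apply: is_derive_eq; rewrite /GRing.scale /=; ring.
have df : is_derive (a * x + b) 1 (derive1n n f) (derive1 (derive1n n f) (a * x + b)).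
  by rewrite derive1E; apply: derivableP; exact: sf.
have dc := @is_derive1_comp _ (derive1n n f) (fun y => a * y + b) x _ _ df da.
have [_ ->] := is_deriveZ (c * a ^+ n) dc.
by rewrite /GRing.scale /= exprSr; ring.
Qed.

Lemma smooth_affine f (a b c : R) : smooth f -> smooth (fun x => c * f (a * x + b)).
Proof.
move=> sf n x; rewrite derive1n_affine //.
have da : is_derive x 1 (fun y : R => a * y + b) a.
  by apply: is_derive_eq; rewrite /GRing.scale /=; ring.
have df : is_derive (a * x + b) 1 (derive1n n f) (derive1 (derive1n n f) (a * x + b)).
  by rewrite derive1E; apply: derivableP; exact: sf.
have dc := @is_derive1_comp _ (derive1n n f) (fun y => a * y + b) x _ _ df da.
by have [? _] := is_deriveZ (c * a ^+ n) dc.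
Qed.

Lemma derive1nD f g n : smooth f -> smooth g ->
  derive1n n (f + g) = derive1n n f + derive1n n g.
Proof.
move=> sf sg; elim: n => // n IH; rewrite !derive1nS IH; apply/funext => x.
by rewrite derive1E deriveD ?sf ?sg // -!derive1E.
Qed.

Lemma smoothD f g : smooth f -> smooth g -> smooth (f + g).
Proof. by move=> sf sg n x; rewrite derive1nD //; apply: derivableD. Qed.

Lemma smooth_continuous f : smooth f -> continuous f.
Proof.
by move=> sf x; apply/differentiable_continuous/derivable1_diffP; exact: (sf 0%N).
Qed.

Lemma smooth_primitive f g : (forall x : R, is_derive x 1 f (g x)) -> smooth g -> smooth f.
Proof.
move=> fg sg [|n] x; first by have [] := fg x.
have -> : derive1n n.+1 f = derive1n n g; last exact: sg.
elim: n => [|n IH]; last by rewrite derive1nS IH.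
by apply/funext => y; rewrite derive1n1 derive1E derive_val.
Qed.

Lemma smooth_derive1 f : smooth f -> smooth (derive1 f).
Proof.
move=> sf n; have -> : derive1n n (derive1 f) = derive1n n.+1 f; last exact: sf.
by elim: n => // n IH; rewrite derive1nS IH.
Qed.

(** The step is the primitive of the classical bump, divided by the total mass of the bump. *)
Lemma smooth_step : exists2 S : R -> R, smooth S &
  [/\ forall x : R, x <= 0 -> S x = 0, forall x : R, 1 <= x -> S x = 1,
      forall x, 0 <= S x <= 1, forall x : R, ~~ (0 < x < 1) -> derive1 S x = 0 &
      exists M, forall x, `|derive1 S x| <= M].
Proof.
pose b := bump_of (1 : {poly R}) 0.
have cb : continuous b by apply: smooth_continuous; exact: smooth_bump_of.
have bE x : b x = if 0 < x < 1 then expR (- (x * (1 - x))^-1) else 0.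
  by rewrite /b /bump_of hornerC expr0 !mul1r.
have b0 x : 0 <= b x.
  by rewrite bE; case: ifP => // _; exact: expR_ge0.
have b1 x : b x <= 1.
  rewrite bE; case: ifP => // /andP[x0 x1].
  rewrite -[leRHS]expR0 ler_expR oppr_le0 invr_ge0.
  by apply: mulr_ge0; rewrite ?subr_ge0 ltW.
have mb : measurable_fun setT b by exact: continuous_measurable_fun.
have ib : mu.-integrable setT (EFin \o b).
  have := @integrable_indic_itv R 0 1 true false; apply: le_integrable => //.
    exact/measurable_EFinP.
  move=> x _; rewrite /= indicE lee_fin.
  have [x01|x01] := boolP (0 < x < 1); last first.
    by rewrite /b bump_of_out // normr0.
  have /andP[x0 x1] := x01; rewrite mem_set ?normr1 ?ger0_norm //=.
  by rewrite in_itv /= !ltW.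
have ibS D : measurable D -> mu.-integrable D (EFin \o b).
  by move=> mD; apply: integrableS ib.
pose P x := (\int[mu]_(t in `]-oo, x]) b t)%R.
have dP (x : R) : is_derive x 1 P (b x).
  have [||||dPx <-] := @continuous_FTC1 R b -oo%O x (x + 1).
  - by rewrite ltrDl.
  - exact: ibS.
  - by rewrite ltNyr.
  - exact: cb.
  by rewrite derive1E; exact: derivableP.
(* The bump vanishes beyond 1, so its primitive is constant there. *)
have PE x : P x = (\int[mu]_(t in `]-oo, (Num.min x 1)]) b t)%R.
  rewrite /P Rintegral_mkcond [RHS]Rintegral_mkcond; congr (Rintegral _ _ _).
  apply/funext => t; rewrite /patch !mem_setE !in_itv /= le_min.
  have [t1|t1] := leP t 1; first by rewrite andbT.
  rewrite andbF; case: ifP => // _; rewrite /b bump_of_out //.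
  by rewrite negb_and -!leNgt (ltW t1) orbT.
have P0 x : x <= 0 -> P x = 0.
  move=> x0; rewrite /P Rintegral_mkcond (_ : _ \_ _ = cst 0) ?Rintegral_cst ?mul0r //.
  apply/funext => t; rewrite /patch !mem_setE !in_itv /=; case: ifP => // tx.
  by rewrite /b bump_of_out // negb_and -!leNgt (le_trans tx x0).
have P_ge0 x : 0 <= P x by apply: Rintegral_ge0.
have P_le1 x : P x <= P 1.
  rewrite PE [leRHS]PE minxx Rintegral_mkcond [leRHS]Rintegral_mkcond.
  apply: le_Rintegral => //.
  - by rewrite -restrict_EFin; apply: (iffLR (integrable_mkcond _ _)) => //; exact: ibS.
  - by rewrite -restrict_EFin; apply: (iffLR (integrable_mkcond _ _)) => //; exact: ibS.
  move=> t _; rewrite /patch !mem_setE !in_itv /= le_min.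
  by case: (t <= 1); rewrite ?andbT ?andbF //; case: ifP.
(* If the mass were 0, the primitive would vanish identically, and so would its derivative, which is
   positive at 1/2. *)
have P1 : 0 < P 1.
  rewrite lt_def P_ge0 andbT; apply/eqP => P10.
  have PX : P = cst 0.
    by apply/funext => x; apply/eqP; rewrite eq_le P_ge0 andbT -P10 P_le1.
  have := dP 2^-1; rewrite PX => -[_].
  rewrite derive_cst bE => /esym/eqP; rewrite ifT.
    by rewrite gt_eqF // expR_gt0.
  by apply/andP; lra.
have sP : smooth P by apply: smooth_primitive dP _; exact: smooth_bump_of.
have dS x : derive1 (fun x => (P 1)^-1 * P (1 * x + 0)) x = (P 1)^-1 * b x.
  have := derive1n_affine 1 0 (P 1)^-1 1 sP; rewrite !derive1n1 => ->.
  rewrite expr1 mulr1 mul1r addr0 derive1E.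
  by have [_ ->] := dP x.
exists (fun x => (P 1)^-1 * P (1 * x + 0)); first exact: smooth_affine.
split=> [x x0|x x1|x|x x01|].
- by rewrite mul1r addr0 (P0 x) // mulr0.
- by rewrite mul1r addr0 (PE x) min_r // mulVf // gt_eqF.
- rewrite mul1r addr0 mulr_ge0 ?invr_ge0 //=.
  by rewrite mulrC ler_pdivrMr // mul1r.
- by rewrite dS /b bump_of_out // mulr0.
exists (P 1)^-1 => x.
by rewrite dS normrM !ger0_norm ?invr_ge0 // ler_piMr // invr_ge0.
Qed.

End smooth.

(** * Simple functions and the lower integral *)

Section lower_integral.
Local Open Scope ereal_scope.
Context d (T : measurableType d) (R : realType).
Variable mu : {measure set T -> \bar R}.

(* The integral is a lower integral, so [g] need not be measurable. *)
Lemma ae_le_integral_lower (D : set T) (f g : T -> \bar R) :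
  measurable D -> measurable_fun D f ->
  (forall x, D x -> 0 <= f x) -> (forall x, D x -> 0 <= g x) ->
  {ae mu, forall x, D x -> f x <= g x} ->
  \int[mu]_(x in D) f x <= \int[mu]_(x in D) g x.
Proof.
move=> mD mf f0 g0 [N [mN N0 fgN]].
rewrite (ge0_negligible_integral mN) // !ge0_integralE //; last by move=> x [/f0].
apply: le_ereal_sup => _ /= [h hf <-]; exists h => // x; apply: le_trans (hf x) _.
rewrite /patch.
case: ifPn => [|_]; last by case: ifPn => [|//]; rewrite inE => /g0.
rewrite inE => -[Dx Nx]; rewrite mem_set //.
by apply: contrapT => fg; apply: Nx; apply: fgN => /(_ Dx).
Qed.

End lower_integral.

(** * Everywhere limits of simple functions and their measurability *)

Section simple_limits.
Context {R : realType} {k : field_kind}.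
Local Notation mu := (@lebesgue_measure R).
Local Notation mR := (measurableTypeR R).

Section normed.
Context {V : normedModType (scalar_field R k)}.
Implicit Types (f s : R -> V).

(** Convergence is required at every point, not only almost everywhere, so that norms and inner
    products of the limit are measurable functions. *)
Definition simple_limit f := exists2 s : nat -> R -> V,
  forall n, simple (s n) & forall t, s n t @[n --> \oo] --> f t.

Lemma simple_preimage s (B : set V) : simple s -> measurable (s @^-1` B : set mR).
Proof.
move=> [fs ms].
have -> : s @^-1` B = \bigcup_(v in range s `&` B) (s @^-1` [set v]).
  apply/seteqP; split => [t Bt|t [v [_ Bv] /= ->]] //.
  by exists (s t) => //; split => //; exists t.
apply: fin_bigcup_measurable; last by move=> v _; exact: ms.
by apply: sub_finite_set fs => v [].
Qed.

Lemma simple_measurable s (phi : V -> R) :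
  simple s -> measurable_fun (setT : set mR) (phi \o s).
Proof.
move=> ss _ B mB; rewrite setTI comp_preimage.
exact: simple_preimage.
Qed.

Lemma simple_comp (W : normedModType (scalar_field R k)) (phi : V -> W) s :
  simple s -> simple (phi \o s).
Proof.
move=> ss; split; last by move=> v; rewrite comp_preimage; exact: simple_preimage.
by rewrite -(image_comp s phi); apply: finite_image; exact: ss.1.
Qed.

Lemma simple_patch s (A : set R) :
  measurable (A : set mR) -> simple s -> simple (patch (fun=> 0) A s).
Proof.
move=> mA ss; split.
  apply: (@sub_finite_set _ _ (range s `|` [set 0])).
    move=> _ [t _ <-]; rewrite /patch; case: ifP => _; last by right.
    by left; exists t.
  by rewrite finite_setU; split => //; exact: ss.1.
move=> v.
have -> : patch (fun=> 0) A s @^-1` [set v] =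
    (A `&` s @^-1` [set v]) `|` (~` A `&` [set _ | 0 = v]).
  apply/seteqP; split => t /=; rewrite /patch.
    by case: ifPn; rewrite ?(inE, notin_setE) => At <-; [left|right].
  by case=> -[At tv]; [rewrite mem_set|rewrite memNset].
apply: measurableU; apply: measurableI => //.
- exact: simple_preimage.
- exact: measurableC.
have [v0|v0] := pselect (0 = v).
  by rewrite (_ : [set _ | _] = setT) //; apply/seteqP; split.
by rewrite (_ : [set _ | _] = set0) //; apply/seteqP; split.
Qed.

(** Take a measurable null set [N] containing the points of [D] where convergence fails, and replace
    both [f] and the simple functions by 0 outside [D] minus [N]. *)
Lemma strongly_measurable_simple_limit (D : set R) f :
  measurable (D : set mR) -> strongly_measurable D f ->
  exists2 g, simple_limit g & {ae mu, forall t, D t -> f t = g t}.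
Proof.
move=> mD [s [ss [N [mN N0 sN]]]].
exists (patch (fun=> 0) (D `\` N) f).
  exists (fun n => patch (fun=> 0) (D `\` N) (s n)).
    by move=> n; apply: simple_patch => //; exact: measurableD.
  move=> t; rewrite /patch; case: ifPn => [|_]; last exact: cvg_cst.
  by rewrite inE => -[Dt Nt]; apply: contrapT => h; apply: Nt; apply: sN => /(_ Dt).
exists N; split => // t /= /not_implyP[Dt]; rewrite /patch; case: ifPn => //.
by rewrite notin_setE => /not_andP[|/contrapT].
Qed.

Lemma simple_limit_nrm_measurable f :
  simple_limit f -> measurable_fun (setT : set mR) (fun t => nrm (f t)).
Proof.
move=> [s ss sf].
apply: (@measurable_fun_cvg _ _ _ _ (fun n t => nrm (s n t))) => [n|t _].
  exact: simple_measurable (ss n).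
exact: cvg_nrm.
Qed.

End normed.

Lemma cvg_rip {V : hilbertType R k} {T : Type} (F : set_system T) {FF : Filter F}
    (f : T -> V) x e : f @ F --> x -> rip (f t) e @[t --> F] --> rip x e.
Proof.
move=> fx; apply/cvgrPdist_lt => eps eps0.
have : forall d, 0 < d -> \forall t \near F, nrm (x - f t) < d by apply/cvg_nrmP.
move=> /(_ (eps / (nrm e + 1))); rewrite divr_gt0 ?ltr_wpDl ?nrm_ge0 // => /(_ isT).
apply: filterS => t; rewrite ltr_pdivlMr ?ltr_wpDl ?nrm_ge0 // -ripBl.
apply: le_lt_trans; apply: le_trans (le_rip _ _) _.
by rewrite ler_wpM2l ?nrm_ge0 // lerDl.
Qed.

Lemma simple_limit_rip_measurable {V : hilbertType R k} (f : R -> V) e :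
  simple_limit f -> measurable_fun (setT : set mR) (fun t => rip (f t) e).
Proof.
move=> [s ss sf].
apply: (@measurable_fun_cvg _ _ _ _ (fun n t => rip (s n t) e)) => [n|t _].
  exact: (simple_measurable (rip^~ e) (ss n)).
exact: cvg_rip.
Qed.

End simple_limits.

(** * Weak derivatives of real functions *)

Lemma integrable_bounded_mul d (T : measurableType d) (R : realType)
    (mu : {measure set T -> \bar R}) (D : set T) (h f : T -> R) (C : R) :
  measurable D -> measurable_fun D h -> (forall x, D x -> `|h x| <= C) ->
  mu.-integrable D (EFin \o f) -> mu.-integrable D (EFin \o (h \* f)).
Proof.
move=> mD mh hC fi.
have := integrableMr mD mh _ fi; apply.
by exists C; split => [|x Cx y Dy]; rewrite ?num_real //= (le_trans (hC _ Dy)) // ltW.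
Qed.

Section weak_derivative_real.
Context {R : realType}.
Local Notation mu := (@lebesgue_measure R).
Local Notation mR := (measurableTypeR R).
Implicit Types (g h : R -> R).

Variables (S : R -> R) (M : R).
Hypotheses (smS : smooth S) (S0 : forall x : R, x <= 0 -> S x = 0)
  (S1 : forall x : R, 1 <= x -> S x = 1) (S01 : forall x, 0 <= S x <= 1)
  (S'0 : forall x : R, ~~ (0 < x < 1) -> derive1 S x = 0)
  (S'M : forall x, `|derive1 S x| <= M).

(** For d > 0, [step c d] rises smoothly from 0 at c to 1 at c + d. Its derivative [kernel c d] is
    supported in [c, c + d], has integral 1 and is bounded by M / d. *)
Let step (c d x : R) := 1 * S (d^-1 * x + - (c / d)).
Let kernel (c d x : R) := d^-1 * derive1 S (d^-1 * x + - (c / d)).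

Let smooth_step_cd c d : smooth (step c d). Proof. exact: smooth_affine. Qed.

Let derive1_step c d : derive1 (step c d) = kernel c d.
Proof.
have := derive1n_affine d^-1 (- (c / d)) 1 1 smS; rewrite !derive1n1 => ->.
by rewrite expr1 mul1r.
Qed.

Let affE (c d x : R) : d^-1 * x + - (c / d) = (x - c) / d.
Proof. by rewrite mulrBl mulrC. Qed.

Let kernel_out c d x : 0 < d -> ~ (c <= x <= c + d) -> kernel c d x = 0.
Proof.
move=> d0 /negP xcd; rewrite /kernel S'0 ?mulr0 // affE; apply: contra xcd.
rewrite ltr_pdivlMr // ltr_pdivrMr // mul0r mul1r subr_gt0 ltrBlDl.
by case/andP => /ltW -> /ltW ->.
Qed.

Let kernel_le c d x : 0 < d -> `|kernel c d x| <= M / d.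
Proof.
move=> d0; rewrite /kernel normrM ger0_norm ?invr_ge0 ?(ltW d0) // [leLHS]mulrC.
by rewrite ler_wpM2r // invr_ge0 ltW.
Qed.

Let continuous_kernel c d : continuous (kernel c d).
Proof.
rewrite -derive1_step; apply: smooth_continuous.
exact/smooth_derive1/smooth_step_cd.
Qed.

Let Rintegral_kernel c d : 0 < d -> (\int[mu]_(x in `[c, (c + d)]) kernel c d x)%R = 1.
Proof.
move=> d0; rewrite /Rintegral (@continuous_FTC2 _ _ (step c d)).
- rewrite -EFinB /= /step !affE subrr mul0r (addrC c) addrK divff ?gt_eqF //.
  by rewrite S1 // S0 // mulr1 mulr0 subr0.
- by rewrite ltrDl.
- by apply: continuous_subspaceT => x; exact: continuous_kernel.
- split=> [x _||]; first exact: (@smooth_step_cd c d 0%N x).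
    apply: cvg_at_right_filter; exact: smooth_continuous.
  apply: cvg_at_left_filter; exact: smooth_continuous.
by move=> x _; rewrite derive1_step.
Qed.

(** Since the kernel has mass 1, g y can be put under the integral. The kernel is at most M / d and
    [c, c + d] lies in the ball of radius 2d about y, whose measure is 4d, so the error is at most
    4M times the mean oscillation of g over that ball. *)
Lemma kernel_average g a b c d y : 0 < a -> a <= c -> c + d <= b -> 0 < d ->
  c <= y <= c + d -> measurable_fun (setT : set mR) g ->
  mu.-integrable `[a, b] (EFin \o g) ->
  mu.-integrable `]0, +oo[ (EFin \o (kernel c d \* g)) /\
  (`|\int[mu]_(x in `]0%R, +oo[) (kernel c d x * g x) - g y|%:E
    <= (4 * M)%:E * davg (g \_ `[a, b]) y (2 * d))%E.
Proof.
move=> a0 ac cb d0 /andP[cy yd] mg ig.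
set K := kernel c d; set I := `[c, (c + d)]%classic : set R.
have mK D : measurable_fun (D : set mR) K.
  by apply: measurable_funTS; apply: continuous_measurable_fun; exact: continuous_kernel.
have Iab : I `<=` `[a, b].
  move=> x; rewrite /I /= !in_itv /= => /andP[cx xd].
  by rewrite (le_trans ac cx) (le_trans xd cb).
have I0 : I `<=` `]0, +oo[.
  by move=> x /Iab; rewrite /= !in_itv /= andbT => /andP[ax _]; exact: lt_le_trans ax.
have mI : measurable (I : set mR) by exact: measurable_itv.
have muI : (mu I < +oo)%E by rewrite lebesgue_measure_itv /=; case: ifP; rewrite ?ltry.
have igI : mu.-integrable I (EFin \o g) by apply: integrableS ig.
have bK D x : D x -> `|K x| <= M / d by move=> _; exact: kernel_le.
have iI : mu.-integrable I (EFin \o (K \* g)).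
  by apply: (@integrable_bounded_mul _ _ _ mu I K g (M / d)) => //; exact: bK.
(* The product is supported in [c, c + d], so the integral over the half-line reduces to this
   interval. *)
have KgE : (K \* g) \_ `]0, +oo[ = (K \* g) \_ I.
  apply/funext => x; rewrite /patch; case: ifPn => [_|].
    case: ifPn => //; rewrite notin_setE /I /= in_itv /= => xI.
    by rewrite /K kernel_out // mul0r.
  by rewrite notin_setE => x0; rewrite memNset // => /I0.
split.
  apply/integrable_mkcond => //; rewrite restrict_EFin KgE -restrict_EFin.
  by apply: (iffLR (integrable_mkcond _ _)).
rewrite Rintegral_mkcond KgE -Rintegral_mkcond.
have i1 : mu.-integrable I (EFin \o cst (g y)).
  by apply: measurable_bounded_integrable => //; exact: bounded_cst.
have iKy : mu.-integrable I (EFin \o (K \* cst (g y))).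
  by apply: (@integrable_bounded_mul _ _ _ mu I K (cst (g y)) (M / d)) => //; exact: bK.
have iKI : mu.-integrable I (EFin \o K).
  apply: measurable_bounded_integrable => //.
  exists (M / d); split => [|x Mx t It]; rewrite ?num_real //=.
  by rewrite (le_trans (bK I t It)) // ltW.
have -> : g y = (\int[mu]_(x in I) (K x * g y))%R.
  by rewrite RintegralZr // Rintegral_kernel // mul1r.
rewrite -RintegralB //.
have iB : mu.-integrable I (EFin \o (fun x => K x * g x - K x * g y)).
  exact: (integrableB mI iI iKy).
apply: (@le_trans _ _ (\int[mu]_(x in I) `|K x * g x - K x * g y|%:E)%E).
  rewrite EFin_normr_Rintegral //; apply: le_abse_integral => //.
  exact: measurable_int iB.
set G := g \_ `[a, b].
have mG D : measurable_fun (D : set mR) G.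
  apply: measurable_funTS; apply/(measurable_restrictT _ _).1 => //.
  exact: measurable_funTS.
have GE x : I x -> G x = g x by move=> /Iab abx; rewrite /G patchT ?inE.
have Iy : I y by rewrite /I /= in_itv /= cy yd.
have IB : I `<=` ball y (2 * d).
  move=> x; rewrite /I /= in_itv /= => /andP[cx xd].
  by rewrite ball_itv /= in_itv /=; apply/andP; split; lra.
have M0 : 0 <= M by apply: le_trans (S'M 0).
have Md0 : 0 <= M / d by rewrite divr_ge0 // ltW.
have mGy D : measurable_fun (D : set mR) (fun x => `|(G x - G y)%:E|)%E.
  by apply/measurableT_comp => //; apply/measurable_EFinP; exact: measurable_funB.
apply: (@le_trans _ _ (\int[mu]_(x in I) ((M / d)%:E * `|(G x - G y)%:E|))%E).
  apply: ge0_le_integral => //.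
  - apply/measurable_EFinP; apply: measurableT_comp => //.
    by apply: measurable_funB; apply: measurable_funM => //; exact: measurable_funTS.
  - by apply: emeasurable_funM.
  - move=> x Ix; rewrite -EFinM lee_fin GE // GE // -mulrBr normrM.
    by rewrite ler_wpM2r //; exact: kernel_le.
rewrite ge0_integralZl_EFin //.
rewrite /davg /iavg lebesgue_measure_ball; last by rewrite mulr_ge0 // ltW.
have d4 : (2 * d) *+ 2 != 0 by rewrite gt_eqF // mulrn_wgt0 // mulr_gt0.
rewrite inver (negbTE d4) muleA -EFinM.
have -> : 4 * M * ((2 * d) *+ 2)^-1 = M / d by field; rewrite gt_eqF.
apply: lee_wpmul2l; first by rewrite lee_fin.
apply: ge0_subset_integral => //; exact: measurable_ball.
Qed.

Lemma step_diff_le1 (c1 c2 d x : R) : `|step c1 d x - step c2 d x| <= 1.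
Proof.
rewrite /step !mul1r; have /andP[A A'] := S01 (d^-1 * x + - (c1 / d)).
by have /andP[B B'] := S01 (d^-1 * x + - (c2 / d)); rewrite ler_norml; apply/andP; lra.
Qed.

(** This difference is the smooth approximation of the indicator of [r, t]: it rises on [r, r + d]
    and falls on [t - d, t]. *)
Lemma step_diff_out r t d x : 0 < d -> d <= t - r -> ~ (r <= x <= t) ->
  step r d x - step (t - d) d x = 0.
Proof.
move=> d0 dtr /negP; rewrite negb_and -!ltNge /step !affE !mul1r => /orP[xr|tx].
  by rewrite !S0 ?subrr // ler_pdivrMr // mul0r; lra.
by rewrite !S1 ?subrr // ler_pdivlMr // mul1r; lra.
Qed.

Lemma test_function_step_diff r t d : 0 < r -> 0 < d -> d <= t - r ->
  test_function (step r d - step (t - d) d).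
Proof.
move=> r0 d0 dtr; split; last by exists r, t; split => // x; exact: step_diff_out.
have -> : - step (t - d) d = (fun x => (-1) * S (d^-1 * x + - ((t - d) / d))).
  by apply/funext => x; rewrite -[LHS]/(- step (t - d) d x) /step mul1r mulN1r.
by apply: smoothD; exact: smooth_affine.
Qed.

Lemma derive1_step_diff c1 c2 d x :
  derive1 (step c1 d - step c2 d) x = kernel c1 d x - kernel c2 d x.
Proof.
have D c y : derivable (step c d) y 1 by exact: (@smooth_step_cd c d 0%N y).
by rewrite derive1E deriveB // -!derive1E !derive1_step.
Qed.

Lemma lebesgue_pt_near (f : R -> R) (x e : R) : 0 < e -> lebesgue_pt f x ->
  \forall d \near 0^'+, (davg f x d < e%:E)%E.
Proof.
move=> e0 fx; have : nbhs (0 : \bar R)%E [set y | (y < e%:E)%E].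
  by apply: open_nbhs_nbhs; split; [exact: open_ereal_lt_ereal|rewrite /= lte_fin].
by move/fx.
Qed.

(** Test against the smoothed indicator of [r, t]. Its derivative is a difference of kernels at r
    and t, so at Lebesgue points the pairing with g is close to g r - g t, while the pairing with h
    is bounded by the integral of |h|. *)
Lemma weak_derivative_lebesgue_pt g h a b r t : 0 < a -> a < r -> r < t -> t < b ->
  measurable_fun (setT : set mR) g -> mu.-integrable `[a, b] (EFin \o g) ->
  mu.-integrable `[r, t] (EFin \o h) ->
  (forall phi, test_function phi -> (\int[mu]_(x in `]0%R, +oo[) (derive1 phi x * g x) =
     - \int[mu]_(x in `]0%R, +oo[) (phi x * h x))%R) ->
  lebesgue_pt (g \_ `[a, b]) r -> lebesgue_pt (g \_ `[a, b]) t ->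
  `|g t - g r| <= \int[mu]_(x in `[r, t]) `|h x|.
Proof.
move=> a0 ar rt tb mg ig ih weak gr gt.
have M0 : 0 <= M by apply: le_trans (S'M 0).
have M1 : 0 < 8 * (M + 1) by rewrite mulr_gt0 // ltr_pwDr.
apply/ler_addgt0Pr => e e0.
(* After multiplication by the factor 4M of [kernel_average] this is at most e / 2; M + 1 keeps the
   denominator positive. *)
have e1 : 0 < e / (8 * (M + 1)) by rewrite divr_gt0.
have [d [d0 d1 dr dt]] : exists d, [/\ 0 < d, d <= t - r,
    (davg (g \_ `[a, b]) r (2 * d) < (e / (8 * (M + 1)))%:E)%E &
    (davg (g \_ `[a, b]) t (2 * d) < (e / (8 * (M + 1)))%:E)%E].
  near (0:R)^'+ => d2; exists (d2 / 2); have d2E : 2 * (d2 / 2) = d2 by field.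
  split; rewrite ?d2E.
  - by rewrite divr_gt0.
  - rewrite ler_pdivrMr //; near: d2; apply: nbhs_right_le.
    by rewrite mulr_gt0 // subr_gt0.
  - near: d2; exact: lebesgue_pt_near.
  - near: d2; exact: lebesgue_pt_near.
have K y c : a <= c -> c + d <= b -> c <= y <= c + d ->
    (davg (g \_ `[a, b]) y (2 * d) < (e / (8 * (M + 1)))%:E)%E ->
    mu.-integrable `]0, +oo[ (EFin \o (kernel c d \* g)) /\
    `|\int[mu]_(x in `]0%R, +oo[) (kernel c d x * g x) - g y| <= e / 2.
  move=> ac cb cy ye; have [? h1] := kernel_average a0 ac cb d0 cy mg ig; split => //.
  rewrite -lee_fin; apply: le_trans h1 _.
  apply: (@le_trans _ _ ((4 * M)%:E * (e / (8 * (M + 1)))%:E)%E).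
    by apply: lee_wpmul2l; [rewrite lee_fin mulr_ge0|exact: ltW].
  rewrite -EFinM lee_fin mulrA ler_pdivrMr //; nra.
(* At r the kernel sits to the right of the point, at t to its left, so that both stay inside
   [r, t]. *)
have [|||//|ir hr] := K r r; [lra|lra|apply/andP; lra|].
have [|||//|it ht] := K t (t - d); [lra|lra|apply/andP; lra|].
have r0 : 0 < r by exact: lt_trans ar.
have := weak _ (test_function_step_diff r0 d0 d1).
under eq_Rintegral do rewrite derive1_step_diff mulrBl.
rewrite RintegralB // => AE.
have : `|\int[mu]_(x in `]0%R, +oo[) ((step r d - step (t - d) d) x * h x)|
    <= \int[mu]_(x in `[r, t]) `|h x|.
  have -> : (\int[mu]_(x in `]0%R, +oo[) ((step r d - step (t - d) d) x * h x))%R =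
     (\int[mu]_(x in `[r, t]) ((step r d - step (t - d) d) x * h x))%R.
    rewrite Rintegral_mkcond [RHS]Rintegral_mkcond; congr (Rintegral _ _ _).
    apply/funext => x; rewrite /patch; case: ifPn => [_|].
      case: ifPn => //; rewrite notin_setE /= in_itv /= => xrt.
      have E0 : (step r d - step (t - d) d) x = 0 by exact: step_diff_out.
      by rewrite E0 mul0r.
    rewrite notin_setE /= in_itv /= andbT => x0; rewrite memNset //= in_itv /=.
    by move=> /andP[rx _]; apply: x0; exact: lt_le_trans rx.
  have ism : mu.-integrable `[r, t] (EFin \o ((step r d - step (t - d) d) \* h)).
    apply: (@integrable_bounded_mul _ _ _ mu _ _ _ 1) => //.
      apply: measurable_funTS; apply: continuous_measurable_fun.
      by move=> x; apply: cvgB; apply: smooth_continuous.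
    by move=> x _; exact: step_diff_le1.
  apply: le_trans (le_normr_Rintegral _ ism) _ => //.
  apply: le_Rintegral => //.
  - exact: integrable_norm.
  - exact: integrable_norm.
  move=> x _; rewrite /= normrM ler_piMl //; exact: step_diff_le1.
move: AE hr ht; set A := (\int[mu]_(x in _) _); set B := (\int[mu]_(x in _) _).
set C := (\int[mu]_(x in _) (_ * h x)); set D := (\int[mu]_(x in _) `|h x|).
rewrite !ler_norml => AE /andP[? ?] /andP[? ?] /andP[? ?]; apply/andP; lra.
Unshelve. all: by end_near. Qed.

End weak_derivative_real.

(** * Bochner integrals and weak derivatives in a Hilbert space *)

Section bochner.
Context {R : realType} {k : field_kind} {V : hilbertType R k}.
Local Notation mu := (@lebesgue_measure R).
Local Notation mR := (measurableTypeR R).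
Implicit Types (D : set R) (f s : R -> V) (e : V).

Lemma Rintegral_sum D I (r : seq I) (F : I -> R -> R) :
  measurable (D : set mR) -> (forall i, mu.-integrable D (EFin \o F i)) ->
  mu.-integrable D (EFin \o (fun t => \sum_(i <- r) F i t)) /\
  \int[mu]_(t in D) (\sum_(i <- r) F i t) = \sum_(i <- r) \int[mu]_(t in D) F i t.
Proof.
move=> mD iF; elim: r => [|i r [IH1 IH2]].
  split.
    rewrite (_ : EFin \o _ = cst 0%E); last by apply/funext => t; rewrite /= big_nil.
    exact: integrable0.
  rewrite big_nil; under eq_Rintegral do rewrite big_nil.
  by rewrite Rintegral_cst // mul0r.
split.
  rewrite (_ : EFin \o _ = (EFin \o F i) \+ (EFin \o (fun t => \sum_(i <- r) F i t))).
    exact: integrableD.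
  by apply/funext => t; rewrite /= big_cons EFinD.
rewrite big_cons; under eq_Rintegral do rewrite big_cons.
by rewrite RintegralD // IH2.
Qed.

Lemma L1norm_integrable_rip D s e : measurable (D : set mR) -> simple s ->
  (L1norm D s < +oo)%E ->
  mu.-integrable D (EFin \o (fun t => nrm (s t))) /\
  mu.-integrable D (EFin \o (fun t => rip (s t) e)).
Proof.
move=> mD ss soo.
have mn D' : measurable_fun (D' : set mR) (fun t => nrm (s t)).
  by apply: measurable_funTS; exact: (simple_measurable _ ss).
have iN : mu.-integrable D (EFin \o (fun t => nrm (s t))).
  apply/integrableP; split; first exact/measurable_EFinP.
  by under eq_integral do rewrite /= ger0_norm ?nrm_ge0 //.
split => //.
have iZ : mu.-integrable D (EFin \o (fun t => nrm e * nrm (s t))).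
  by have := integrableZl mD (nrm e) iN.
apply: le_integrable iZ => //.
  apply/measurable_EFinP; apply: measurable_funTS.
  exact: (simple_measurable (rip^~ e) ss).
move=> t _; rewrite /= lee_fin [leRHS]ger0_norm ?mulr_ge0 ?nrm_ge0 // mulrC.
exact: le_rip.
Qed.

(** A simple function is the finite sum of its values times the indicators of its level sets; pair
    with e and integrate term by term. *)
Lemma Rintegral_rip_simple D s e : measurable (D : set mR) -> simple s ->
  (L1norm D s < +oo)%E ->
  \int[mu]_(t in D) rip (s t) e = rip (simple_integral D s) e.
Proof.
move=> mD ss soo; have [iN ir] := L1norm_integrable_rip e mD ss soo.
have fs := ss.1.
have ms v : measurable (s @^-1` [set v] : set mR) by exact: ss.2.
pose F v t := rip v e * \1_(s @^-1` [set v]) t.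
have iF v : mu.-integrable D (EFin \o F v).
  apply: (@le_integrable _ _ _ mu _ mD _ (EFin \o (fun t => nrm e * nrm (s t)))).
  - by apply/measurable_EFinP; apply: measurable_funM => //; exact: measurable_indic.
  - move=> t _; rewrite /= lee_fin /F normrM [leRHS]ger0_norm ?mulr_ge0 ?nrm_ge0 //.
    have [sv|sv] := pselect (s t = v); last first.
      by rewrite indicE memNset ?normr0 ?mulr0 ?mulr_ge0 ?nrm_ge0.
    by rewrite indicE mem_set // normr1 mulr1 -sv [leRHS]mulrC; exact: le_rip.
  - by have := integrableZl mD (nrm e) iN.
rewrite /simple_integral fsbig_finite //= rip_sum.
have -> : (fun t => rip (s t) e) = (fun t => \sum_(v <- fset_set (range s)) F v t).
  apply/funext => t; rewrite (bigD1_seq (s t)) ?fset_uniq //=; last first.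
    by rewrite in_fset_set // inE; exists t.
  rewrite /F indicE mem_set // mulr1 big1 ?addr0 // => v vs.
  rewrite indicE memNset ?mulr0 //= => stv; by rewrite stv eqxx in vs.
rewrite (Rintegral_sum _ mD iF).2; apply: eq_bigr => v _.
rewrite ripZl.
(* A level set of infinite measure is possible only if the pairing is 0, and then both sides vanish.
   Otherwise dividing by the pairing shows that the indicator is integrable. *)
have [rv0|rv0] := eqVneq (rip v e) 0.
  rewrite rv0 mulr0; under eq_Rintegral do rewrite /F rv0 mul0r.
  by rewrite Rintegral_cst // mul0r.
have i1 : mu.-integrable D (EFin \o \1_(s @^-1` [set v])).
  have := integrableZl mD (rip v e)^-1 (iF v).
  congr (mu.-integrable _ _); apply/funext => t.
  by rewrite /= /F -EFinM mulrA mulVf // mul1r.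
rewrite RintegralZl // mulrC; congr (_ * _).
by rewrite /Rintegral integral_indic // setIC.
Qed.

(** Here [F] is a measurable version of the pairing of [f] with [e]. Its L1 distance to the pairing
    of the simple functions with [e] is controlled by the L1 distance in the definition of the
    Bochner integral, so the integrals converge to the pairing of [I] with [e]. *)
Lemma bochner_integral_rip D f I e (F : R -> R) : measurable (D : set mR) ->
  is_bochner_integral D f I -> measurable_fun (D : set mR) F ->
  {ae mu, forall t, D t -> rip (f t) e = F t} ->
  mu.-integrable D (EFin \o F) /\ \int[mu]_(t in D) F t = rip I e.
Proof.
move=> mD [_ [s [ss cv cI]]] mF fF.
have c0 : 0 < nrm e + 1 by rewrite ltr_wpDl ?nrm_ge0.
have mr n : measurable_fun (D : set mR) (fun t => rip (s n t) e).
  by apply: measurable_funTS; exact: (simple_measurable (rip^~ e) (ss n).1).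
have mB n : measurable_fun D (fun t => `|F t - rip (s n t) e|%:E).
  apply/measurable_EFinP; apply: measurableT_comp => //; exact: (measurable_funB mF (mr n)).
(* The constant |e| + 1 replaces |e| in order to be invertible. The right-hand side is a lower
   integral, as [f] itself need not be measurable. *)
have B n : (\int[mu]_(t in D) `|F t - rip (s n t) e|%:E
    <= (nrm e + 1)%:E * L1norm D (f \- s n)%R)%E.
  rewrite -lee_pdivrMl // -ge0_integralZl_EFin ?invr_ge0 ?(ltW c0) //; last exact: mB.
  apply: ae_le_integral_lower => //.
  - by apply: emeasurable_funM => //; exact: mB.
  - by move=> t _; rewrite mule_ge0 // lee_fin invr_ge0 ltW.
  - by move=> t _; rewrite lee_fin nrm_ge0.
  apply: (@filterS _ _ (ae_filter_ringOfSetsType mu) _ _ _ fF) => t {}fF Dt.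
  rewrite -EFinM lee_fin ler_pdivrMl // -fF // -ripBl mulrC.
  by apply: le_trans (le_rip _ _) _; rewrite ler_wpM2l ?nrm_ge0 // lerDl.
have cvL d : 0 < d -> \forall n \near \oo, (L1norm D (f \- s n)%R < d%:E)%E.
  move=> d0; have : nbhs (0 : \bar R)%E [set y | (y < d%:E)%E].
    by apply: open_nbhs_nbhs; split; [exact: open_ereal_lt_ereal|rewrite /= lte_fin].
  by move/cv.
have ir m : mu.-integrable D (EFin \o (fun t => rip (s m t) e)).
  have [sn soo] := ss m; exact: (L1norm_integrable_rip e mD sn soo).2.
have iF : mu.-integrable D (EFin \o F).
  have [n _ /(_ n (leqnn n)) Ln] := cvL 1 ltr01.
  have iB : mu.-integrable D (EFin \o (fun t => F t - rip (s n t) e)).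
    apply/integrableP; split.
      by apply/measurable_EFinP; exact: (measurable_funB mF (mr n)).
    apply: le_lt_trans (B n) _; apply: lte_mul_pinfty => //.
      by rewrite lee_fin ltW.
    exact: lt_trans Ln (ltry _).
  have := integrableD mD iB (ir n); congr (mu.-integrable _ _).
  by apply/funext => t; rewrite /= -EFinD subrK.
split => //; apply/eqP; rewrite -subr_eq0 -normr_le0; apply/ler_addgt0Pr => eps eps0.
rewrite add0r.
have e1 : 0 < eps / 2 / (nrm e + 1) by rewrite !divr_gt0.
have e2 : 0 < eps / 2 by rewrite divr_gt0.
have cr : rip (simple_integral D (s n)) e @[n --> \oo] --> rip I e by exact: cvg_rip.
have [n [n1 n2]] : exists n, (L1norm D (f \- s n)%R < (eps / 2 / (nrm e + 1))%:E)%E /\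
     `|rip I e - rip (simple_integral D (s n)) e| < eps / 2.
  near \oo => n; exists n; split; near: n; first exact: cvL.
  by move/cvgrPdist_lt : cr; apply.
have h : `|\int[mu]_(t in D) F t - rip (simple_integral D (s n)) e| <= eps / 2.
  have [sn soo] := ss n.
  rewrite -Rintegral_rip_simple // -RintegralB //.
  have iB : mu.-integrable D (EFin \o (fun t => F t - rip (s n t) e)).
    exact: (integrableB mD iF (ir n)).
  rewrite -lee_fin EFin_normr_Rintegral //.
  apply: le_trans (le_abse_integral _ _ (measurable_int _ iB)) _ => //.
  apply: le_trans (B n) _.
  rewrite muleC -lee_pdivlMr //; apply: le_trans (ltW n1) _.
  by rewrite -EFinM.
move: h n2; rewrite ler_norml ltr_norml ler_norml => /andP[? ?] /andP[? ?].
by apply/andP; lra.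
Unshelve. all: by end_near. Qed.

End bochner.

(** * Increment bound for weakly differentiable vector-valued functions *)

Section weak_derivative_vector.
Context {R : realType} {k : field_kind} {V : hilbertType R k}.
Local Notation mu := (@lebesgue_measure R).
Local Notation mR := (measurableTypeR R).
Implicit Types (u v : R -> V) (e : V).

Lemma L1loc_nrm_integrable u u' : L1loc u -> simple_limit u' ->
  {ae mu, forall t, `]0, +oo[%classic t -> u t = u' t} ->
  forall a b, 0 < a -> mu.-integrable `[a, b] (EFin \o (fun t => nrm (u' t))).
Proof.
move=> [_ uoo] lu' uu' a b a0.
have mn D : measurable_fun (D : set mR) (fun t => nrm (u' t)).
  by apply: measurable_funTS; exact: simple_limit_nrm_measurable.
have mE : measurable_fun (`[a, b]%classic : set mR) (EFin \o (fun t => nrm (u' t))).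
  exact/measurable_EFinP.
have [ab|ba] := ltP a b; last first.
  have ab0 : mu `[a, b] = 0%E by rewrite lebesgue_measure_itv /= lte_fin ltNge ba.
  exact: null_set_integrable.
apply/integrableP; split => //; apply: le_lt_trans (uoo a b a0 ab).
apply: ae_le_integral_lower => //.
- exact: measurableT_comp.
- by move=> t _; rewrite lee_fin nrm_ge0.
apply: (@filterS _ _ (ae_filter_ringOfSetsType mu) _ _ _ uu') => t uut tab.
rewrite uut ?gee0_abs ?lee_fin ?nrm_ge0 //.
by move: tab; rewrite /= !in_itv /= andbT => /andP[at_ _]; exact: lt_le_trans at_.
Qed.

Lemma nrm_integrable_rip u e D : measurable (D : set mR) -> simple_limit u ->
  mu.-integrable D (EFin \o (fun t => nrm (u t))) ->
  mu.-integrable D (EFin \o (fun t => rip (u t) e)).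
Proof.
move=> mD lu iu.
apply: (@le_integrable _ _ _ mu _ mD _ (EFin \o (fun t => nrm e * nrm (u t)))).
- apply/measurable_EFinP; apply: measurable_funTS.
  exact: simple_limit_rip_measurable.
- move=> t _; rewrite /= lee_fin [leRHS]ger0_norm ?mulr_ge0 ?nrm_ge0 // mulrC.
  exact: le_rip.
- by have := integrableZl mD (nrm e) iu.
Qed.

Lemma weak_derivative_rip u v u' v' e phi :
  is_weak_derivative u v -> simple_limit u' -> simple_limit v' ->
  {ae mu, forall t, `]0, +oo[%classic t -> u t = u' t} ->
  {ae mu, forall t, `]0, +oo[%classic t -> v t = v' t} ->
  test_function phi ->
  \int[mu]_(x in `]0%R, +oo[) (derive1 phi x * rip (u' x) e) =
  - \int[mu]_(x in `]0%R, +oo[) (phi x * rip (v' x) e).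
Proof.
move=> [_ weak] lu' lv' uu' vv' tphi; have [I [Iu Iv]] := weak _ tphi.
have sphi : smooth phi by exact: tphi.1.
have m0 : measurable (`]0, +oo[%classic : set mR) by exact: measurable_itv.
have [||_ ->] := @bochner_integral_rip _ _ _ _ _ I e
    (fun x => derive1 phi x * rip (u' x) e) m0 Iu.
- apply: measurable_funTS; apply: measurable_funM.
    apply: continuous_measurable_fun; apply: smooth_continuous; exact: smooth_derive1.
  exact: simple_limit_rip_measurable.
- apply: (@filterS _ _ (ae_filter_ringOfSetsType mu) _ _ _ uu') => t uut /uut <-.
  exact: ripZl.
have [||_ ->] := @bochner_integral_rip _ _ _ _ _ (- I) e
    (fun x => phi x * rip (v' x) e) m0 Iv.
- apply: measurable_funTS; apply: measurable_funM.
    apply: continuous_measurable_fun; exact: smooth_continuous.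
  exact: simple_limit_rip_measurable.
- apply: (@filterS _ _ (ae_filter_ringOfSetsType mu) _ _ _ vv') => t vvt /vvt <-.
  exact: ripZl.
by rewrite ripNl opprK.
Qed.

(** The increment E of [u'] should be paired with E itself, but E varies with r and t. It is
    replaced by the increments of the approximating simple functions, which take countably many
    values, so a single null set of exceptional points suffices. *)
Lemma weak_derivative_dist u v u' : simple_limit u' ->
  {ae mu, forall t, `]0, +oo[%classic t -> u t = u' t} ->
  (forall a b, 0 < a -> mu.-integrable `[a, b] (EFin \o (fun t => nrm (u' t)))) ->
  is_weak_derivative u v ->
  exists v' (G : set R), [/\ simple_limit v',
    {ae mu, forall t, `]0, +oo[%classic t -> v t = v' t},
    forall a b, 0 < a -> mu.-integrable `[a, b] (EFin \o (fun t => nrm (v' t))),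
    {ae mu, forall t, `]0, +oo[%classic t -> G t} &
    forall r t, 0 < r -> r < t -> G r -> G t ->
      nrm (u t - u r) <= \int[mu]_(x in `[r, t]) nrm (v' x)].
Proof.
move=> lu' uu' iu' uv.
have m0 : measurable (`]0, +oo[%classic : set mR) by exact: measurable_itv.
have [v' lv' vv'] := strongly_measurable_simple_limit m0 uv.1.1.
have iv' := L1loc_nrm_integrable uv.1 lv' vv'.
have [s ss su] := lu'.
(* [q n] lists the finitely many values of [s n]. In [g] the intervals [1/(m+1), m] exhaust the
   half-line and make each function integrable, as Lebesgue differentiation requires. *)
pose q n i := nth 0 (fset_set (range (s n))) i.
pose g n i i' m := (fun t => rip (u' t) (q n i - q n i')) \_ `[m.+1%:R^-1, m%:R].
exists v', [set t | u t = u' t /\ forall n i i' m, lebesgue_pt (g n i i' m) t].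
split => //.
  have Leb : {ae mu, forall t, forall n i i' m, lebesgue_pt (g n i i' m) t}.
    do 4 apply: ae_foralln => ?.
    apply: lebesgue_differentiation; apply: integrable_locally_restrict => //.
    by apply: nrm_integrable_rip => //; apply: iu'; rewrite invr_gt0.
  have FF := ae_filter_ringOfSetsType mu.
  near=> t; move=> t0; split; first by move: t0; near: t.
  by near: t.
move=> r t r0 rt [ur Lr] [ut Lt]; rewrite ut ur.
set J := Rintegral _ _ _; set E := u' t - u' r.
have J0 : 0 <= J by apply: Rintegral_ge0 => x _; exact: nrm_ge0.
have sE : s n t - s n r @[n --> \oo] --> E by apply: cvgB; exact: su.
have [m [mr mt]] : exists m : nat, m.+1%:R^-1 < r /\ t < m%:R.
  pose m := (Num.bound r^-1 + Num.bound t)%N; exists m.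
  have br := archi_boundP (ltW (_ : 0 < r^-1)); rewrite invr_gt0 in br.
  have bt := archi_boundP (ltW (lt_trans r0 rt)).
  split; last by apply: lt_le_trans bt _; rewrite ler_nat leq_addl.
  rewrite -[ltRHS]invrK ltf_pV2 ?posrE ?invr_gt0 //.
  by apply: lt_le_trans (br r0) _; rewrite ler_nat leqW // leq_addr.
have qs n x : exists i, q n i = s n x.
  exists (index (s n x) (fset_set (range (s n)))); apply: nth_index.
  by rewrite in_fset_set; [rewrite inE; exists x|exact: (ss n).1].
have key n : `|rip E (s n t - s n r)| <= nrm (s n t - s n r) * J.
  have [[i ei] [i' ei']] := (qs n t, qs n r).
  have hr := Lr n i i' m; have ht := Lt n i i' m; rewrite /g ei ei' in hr ht.
  have ie a b : 0 < a ->
      mu.-integrable `[a, b] (EFin \o (fun x => rip (v' x) (s n t - s n r))).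
    by move=> a0; apply: nrm_integrable_rip => //; exact: iv'.
  rewrite /E ripBl.
  have [S sS [S0 S1 S01 S'0 [M S'M]]] := @smooth_step R.
  apply: le_trans
    (weak_derivative_lebesgue_pt sS S0 S1 S01 S'0 S'M _ mr rt mt _ _ _ _ hr ht) _.
  - by rewrite invr_gt0.
  - exact: simple_limit_rip_measurable.
  - by apply: nrm_integrable_rip => //; apply: iu'; rewrite invr_gt0.
  - exact: ie.
  - move=> phi tphi; exact: (weak_derivative_rip _ uv lu' lv' uu' vv' tphi).
  rewrite /J -RintegralZl //; last exact: iv'.
  apply: le_Rintegral => //.
  - by apply: integrable_norm; exact: ie.
  - by have := integrableZl _ (nrm (s n t - s n r)) (iv' r t r0); apply.
  by move=> x _; rewrite mulrC; exact: le_rip.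
(* Letting n tend to infinity in [key] gives |E|^2 <= |E| J, and |E| can be cancelled unless it is
   0. *)
have : rip E E <= nrm E * J.
  have cE : rip E (s n t - s n r) @[n --> \oo] --> rip E E.
    by under eq_fun do rewrite ripC; exact: cvg_rip.
  have cJ : nrm (s n t - s n r) * J @[n --> \oo] --> nrm E * J.
    by apply: cvgMl; exact: cvg_nrm.
  apply: ler_cvg_to cE cJ _; apply: nearW => n; apply: le_trans (key n).
  exact: ler_norm.
rewrite rip_nrm.
have [->|E0] := eqVneq (nrm E) 0 => //.
by rewrite expr2 ler_pM2l // lt_def E0 nrm_ge0.
Unshelve. all: by end_near. Qed.

End weak_derivative_vector.

(** * Traces *)

Section trace_real_line.
Context {R : realType} {k : field_kind}.
Local Notation mu := (@lebesgue_measure R).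
Local Notation mR := (measurableTypeR R).

Lemma ae_itv_ex (P : R -> Prop) (a b : R) : 0 <= a -> a < b ->
  {ae mu, forall t, 0 < t -> P t} -> exists t, [/\ a < t, t < b & P t].
Proof.
move=> a0 ab [N [mN N0 PN]]; apply: contrapT => nP.
have : (mu `]a, b[ <= mu N)%E.
  apply: le_measure; rewrite ?inE //.
  move=> t; rewrite /= in_itv /= => /andP[at_ tb]; apply: PN => Pt.
  by apply: nP; exists t; split => //; apply: Pt; exact: le_lt_trans at_.
rewrite [X in (_ <= X)%E]N0 lebesgue_measure_itv /= lte_fin ab -EFinB lee_fin.
by rewrite leNgt subr_gt0 ab.
Qed.

(** A set of full measure meets every interval to the right of t. Limits along such a set therefore
    make sense at each t >= 0, the endpoint 0 included. *)
Lemma ae_within_proper (P : R -> Prop) (t : R) : 0 <= t ->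
  {ae mu, forall t, 0 < t -> P t} ->
  ProperFilter (within [set x | 0 < x /\ P x] (nbhs t)).
Proof.
move=> t0 aeP; apply: within_nbhs_proper => A [e /= e0 eA].
have tte : t < t + e by rewrite ltrDl.
have [x [tx xt Px]] := ae_itv_ex t0 tte aeP.
exists x; split; first by split => //; exact: le_lt_trans tx.
by apply: eA => /=; rewrite ltr_norml; apply/andP; split; lra.
Qed.

Lemma cvg_cauchy_nrm {V : completeNormedModType (scalar_field R k)}
    (F : set_system V) : ProperFilter F ->
  (forall e : R, 0 < e -> exists x : V, F [set y | nrm (x - y) < e]) -> cvg F.
Proof.
move=> FF hF; apply/cauchy_cvgP; apply/cauchy_exP => e e0.
have [x Fx] := hF _ (re_gt0 e0); exists x; apply: filterS Fx => y /=.
by rewrite -ball_normE /ball_ /= -of_real_nrm -[X in _ -> _ < X]of_real_re ?lt_of_real // ltW.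
Qed.

(** * Continuous extension from a set of full measure to the closed half-line *)

Section extension.
Context {V : completeNormedModType (scalar_field R k)}.
Variables (u : R -> V) (G : set R) (C : R) (tau : R -> R).
Hypotheses (C0 : 0 <= C) (aeG : {ae mu, forall t, 0 < t -> G t})
  (uG : forall r t : R, 0 < r -> 0 < t -> G r -> G t ->
    nrm (u r - u t) ^+ 2 <= C * `|tau r - tau t|)
  (ctau : forall t : R, 0 <= t -> tau x @[x --> within [set x | 0 < x] (nbhs t)] --> tau t).

Let F (t : R) := within [set x | 0 < x /\ G x] (nbhs t).

Let tauF (t : R) : 0 <= t -> tau x @[x --> F t] --> tau t.
Proof.
move=> t0; apply: cvg_trans (ctau t0); apply: cvg_app => A.
by apply: (@filterS _ (nbhs t)) => x h [x0 _]; exact: h.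
Qed.

Let FG t : F t [set x | 0 < x /\ G x].
Proof. exact: withinT. Qed.

(** The extension at t is the limit of [u] along [G], which exists by completeness because [tau] is
    continuous. The modulus of continuity then passes to the limit in one variable after the
    other. *)
Lemma hoelder_extension : exists w : R -> V,
  (forall t : R, 0 < t -> G t -> w t = u t) /\
  forall r t : R, 0 <= r -> 0 <= t -> nrm (w r - w t) ^+ 2 <= C * `|tau r - tau t|.
Proof.
have PF (t : R) : 0 <= t -> ProperFilter (F t) by move=> t0; exact: ae_within_proper.
have cF (t : R) : 0 <= t -> cvg (u x @[x --> F t]).
  move=> t0; have := PF _ t0 => PFt; apply: cvg_cauchy_nrm => e e0.
  (* Two points whose [tau] is this close to [tau t] satisfy |u x0 - u x|^2 <= 2 C e^2 / (2 C + 1) <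
     e^2. *)
  have d0 : 0 < e ^+ 2 / (2 * C + 1) by rewrite divr_gt0 ?exprn_gt0 // ltr_wpDl // mulr_ge0.
  have /cvgrPdist_lt/(_ _ d0) near_t := tauF t0.
  have near_tG : F t
      ([set x | `|tau t - tau x| < e ^+ 2 / (2 * C + 1)] `&` [set x | 0 < x /\ G x]).
    exact: filterI near_t (FG t).
  have [x0 [xt [x00 Gx0]]] := filter_ex near_tG.
  exists (u x0); apply: filterS near_tG => x [xxt [x_gt0 Gx]] /=.
  rewrite -(@ltr_pXn2r _ 2) ?nnegrE ?nrm_ge0 ?ltW //.
  apply: le_lt_trans (uG x00 x_gt0 Gx0 Gx) _.
  have h : `|tau x0 - tau x| <= 2 * (e ^+ 2 / (2 * C + 1)).
    rewrite (_ : tau x0 - tau x = (tau t - tau x) - (tau t - tau x0)); last by ring.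
    apply: le_trans (ler_normB _ _) _.
    by move: xt xxt => /= /ltW xt /ltW xxt; rewrite mulr2n mulrDl mul1r lerD.
  apply: le_lt_trans (ler_wpM2l C0 h) _.
  have C1 : 0 < 2 * C + 1 by rewrite ltr_wpDl // mulr_ge0.
  rewrite mulrCA mulrA mulrA ltr_pdivrMr //.
  have e2 : 0 < e ^+ 2 by rewrite exprn_gt0.
  nra.
(* First passage to the limit: one point stays in [G], the other tends to t along [G]. *)
have key (t x : R) : 0 <= t -> 0 < x -> G x ->
    nrm (u x - lim (u x @[x --> F t])) ^+ 2 <= C * `|tau x - tau t|.
  move=> t0 x0 Gx; have := PF _ t0 => PFt.
  have h1 : nrm (u x - u y) ^+ 2 @[y --> F t] --> nrm (u x - lim (u x @[x --> F t])) ^+ 2.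
    apply: cvgM; apply: cvg_nrm; apply: cvgB;
      [exact: cvg_cst|exact: cF|exact: cvg_cst|exact: cF].
  have h2 : C * `|tau x - tau y| @[y --> F t] --> C * `|tau x - tau t|.
    apply: cvgMr; apply: cvg_norm; apply: cvgB; [exact: cvg_cst|exact: tauF].
  apply: ler_cvg_to h1 h2 _; apply: filterS (FG t) => y [y0 Gy]; exact: uG.
exists (fun t => lim (u x @[x --> F t])); split => [t t0 Gt|r t r0 t0].
  apply/eqP; rewrite eq_sym -subr_eq0 -nrm_eq0 -sqrf_eq0.
  by rewrite eq_le sqr_ge0 andbT; have := key t t (ltW t0) t0 Gt; rewrite subrr normr0 mulr0.
have := PF _ r0 => PFr.
have h1 : nrm (u y - lim (u x @[x --> F t])) ^+ 2 @[y --> F r] -->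
    nrm (lim (u x @[x --> F r]) - lim (u x @[x --> F t])) ^+ 2.
  apply: cvgM; apply: cvg_nrm; apply: cvgB;
    [exact: cF|exact: cvg_cst|exact: cF|exact: cvg_cst].
have h2 : C * `|tau y - tau t| @[y --> F r] --> C * `|tau r - tau t|.
  apply: cvgMr; apply: cvg_norm; apply: cvgB; [exact: tauF|exact: cvg_cst].
apply: ler_cvg_to h1 h2 _; apply: filterS (FG r) => y [y0 Gy]; exact: key.
Qed.

End extension.

End trace_real_line.

(** * Uniqueness of traces, a criterion for relative compactness, boundedness of compact
    operators *)

Section traces.
Context {R : realType} {k : field_kind}.
Local Notation mu := (@lebesgue_measure R).

Lemma cvg_eq_along {V : normedModType (scalar_field R k)} {T : topologicalType}
    (F : set_system T) (f g : T -> V) (x y : V) : ProperFilter F ->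
  f @ F --> x -> g @ F --> y -> F [set t | f t = g t] -> x = y.
Proof.
move=> FF fx gy fg; apply/eqP; rewrite -subr_eq0 -nrm_eq0 eq_le nrm_ge0 andbT.
have h : nrm (f t - g t) @[t --> F] --> nrm (x - y) by apply: cvg_nrm; exact: cvgB.
have c : (0 : R) @[_ --> F] --> (0 : R) by exact: cvg_cst.
apply: ler_cvg_to h c _; apply: filterS fg => t /= ->.
by rewrite subrr nrm0.
Qed.

(** Two continuous representatives agree on a set of full measure, which accumulates at every t > 0.
    By continuity they agree on the whole of (0, +oo) and have the same limit at 0. *)
Lemma is_trace_unique {V : normedModType (scalar_field R k)} (u : R -> V) y z :
  is_trace u y -> is_trace u z -> y = z.
Proof.
move=> [v [uv cv vy]] [w [uw cw wz]].
have vw : {ae mu, forall t, 0 < t -> v t = w t}.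
  apply: (@filterS2 _ _ (ae_filter_ringOfSetsType mu) _ _ _ _ uv uw).
  by move=> t ut ut' t0; rewrite -ut // -ut'.
apply: cvg_eq_along vy wz _.
near=> t => /=.
have t0 : 0 < t by [].
have t0i : t \in `]0, +oo[ by rewrite in_itv /= t0.
have PF := ae_within_proper (ltW t0) vw.
apply: (@cvg_eq_along _ _ (within [set x | 0 < x /\ v x = w x] (nbhs t)) v w).
- by apply: cvg_within_filter; exact: cv.
- by apply: cvg_within_filter; exact: cw.
- by apply: nearW => x [].
Unshelve. all: by end_near. Qed.

(** Approximation by compact sets makes [Z] totally bounded. An ultrafilter containing the closure
    then contains a ball of each radius, so it is Cauchy and converges by completeness. *)
Lemma compact_closure_approx {V : completeNormedModType (scalar_field R k)} (Z : set V) :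
  (forall d : R, 0 < d -> exists2 K : set V, compact K &
     forall z, Z z -> exists2 y, K y & nrm (z - y) < d) ->
  compact (closure Z).
Proof.
move=> hZ; rewrite compact_ultra => F UF FZ.
have PF : ProperFilter F by exact: ultra_proper.
have cF : cvg F.
  apply: cvg_cauchy_nrm => e e0.
  have e3 : 0 < e / 3 by rewrite divr_gt0.
  have [K cK ZK] := hZ _ e3.
  move: cK; rewrite compact_cover => /(_ V K (fun x => [set y | nrm (x - y) < e / 3])).
  case.
  - move=> x _; rewrite openE => y /= xy; apply/nbhs_nrmP.
    exists (e / 3 - nrm (x - y)); first by rewrite subr_gt0.
    move=> z /= yz; apply: le_lt_trans (nrm_triangle y _ _) _.
    by move: yz; rewrite ltrBrDl.
  - by move=> x Kx; exists x => //=; rewrite subrr nrm0.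
  move=> D _ KD.
  (* If no ball of radius e about a point of the finite set [D] were in the ultrafilter, it would
     contain a point of the closure outside all of them; three steps of length less than e / 3 lead
     from that point back to [D]. *)
  apply: contrapT => nF.
  have FD : F (\bigcap_(x in [set` D]) ~` [set y | nrm (x - y) < e]).
    apply: filter_bigI => x _.
    have [Fx|//] := in_ultra_setVsetC [set y | nrm (x - y) < e] UF.
    by exfalso; apply: nF; exists x.
  have [z [clz Dz]] := filter_ex (filterI FZ FD).
  have [|z' [Zz' zz']] := clz [set y | nrm (z - y) < e / 3].
    by apply/nbhs_nrmP; exists (e / 3).
  have [y Ky z'y] := ZK _ Zz'; have [x Dx /= xy] := KD _ Ky.
  apply: (Dz x Dx) => /=.
  apply: le_lt_trans (nrm_triangle y _ _) _.
  apply: le_lt_trans (lerD (lexx _) (nrm_triangle z' _ _)) _.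
  by move: xy zz' z'y; rewrite /= (nrm_distC z z') (nrm_distC z' y); lra.
exists (lim F); split => //.
apply: (@closed_closure _ Z) => B /cF FB; exact: filter_ex (filterI FZ FB).
Qed.

(** The image of the unit ball is relatively compact, hence bounded; scaling extends the bound to
    all vectors. *)
Lemma compact_operator_bounded (X Y : hilbertType R k) (j : {linear X -> Y}) :
  compact_operator setT (@nrm R k X) j ->
  exists2 C : R, 0 <= C & forall x, nrm (j x) <= C * nrm x.
Proof.
move=> [_ hj].
have cj : compact (closure (j @` [set x | nrm x <= 1])) by apply: hj => //; exists 1.
have cn : continuous (@nrm R k Y).
  by move=> y; apply: (@cvg_nrm _ _ _ _ (nbhs y) _ id); exact: cvg_id.
have /compact_bounded[M [_ hM]] : compact (@nrm R k Y @` closure (j @` [set x | nrm x <= 1])).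
  by apply: continuous_compact cj; exact: continuous_subspaceT.
have M1 x : nrm x <= 1 -> nrm (j x) <= `|M| + 1.
  move=> x1; rewrite -[leLHS]ger0_norm ?nrm_ge0 //.
  apply: hM; first by rewrite (le_lt_trans (ler_norm _)) // ltrDl.
  by exists (j x) => //; apply: subset_closure; exists x.
exists (`|M| + 1) => [|x]; first by rewrite addr_ge0.
have [->|x0] := eqVneq x 0; first by rewrite linear0 !nrm0 mulr0.
have xp : 0 < nrm x by rewrite lt_def nrm_eq0 x0 nrm_ge0.
rewrite -ler_pdivrMr // mulrC.
have := M1 (of_real k (nrm x)^-1 *: x); rewrite linearZ /= !nrmZ_of_real.
by rewrite ger0_norm ?invr_ge0 ?nrm_ge0 // mulVf ?gt_eqF // => /(_ (lexx _)).
Qed.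

End traces.

(** * Energy estimates *)

(** Pointwise form of the weighted Cauchy-Schwarz inequality. Being linear in N^2 P and 1/P, it can
    be integrated term by term; the parameter l is optimised afterwards. *)
Lemma amgm_weighted (F : realFieldType) (l N P : F) : 0 < l -> 0 < P ->
  2 * N <= l * (N ^+ 2 * P) + l^-1 * P^-1.
Proof.
move=> l0 P0; rewrite -subr_ge0.
have -> : l * (N ^+ 2 * P) + l^-1 * P^-1 - 2 * N = (l * P)^-1 * (l * N * P - 1) ^+ 2.
  by field; rewrite !gt_eqF.
by rewrite mulr_ge0 ?sqr_ge0 // invr_ge0 ltW // mulr_gt0.
Qed.

(** The optimal parameter is l = D / a, for which the bound reads 2 D <= D + a b / D. *)
Lemma sqr_le_of_amgm (F : realFieldType) (D a b : F) : 0 <= D -> 0 <= a -> 0 <= b ->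
  (forall l, 0 < l -> 2 * D <= l * a + l^-1 * b) -> D ^+ 2 <= a * b.
Proof.
move=> D0 a0 b0 h; have [->|Dn0] := eqVneq D 0; first by rewrite expr0n mulr_ge0.
have Dp : 0 < D by rewrite lt_def Dn0.
(* For a = 0 there is no optimal parameter; l = (b + 1) / D gives 2 D <= D b / (b + 1), which is
   impossible. *)
have [a00|an0] := eqVneq a 0.
  have b1 : 0 < b + 1 by rewrite ltr_wpDl.
  have := h ((b + 1) / D); rewrite divr_gt0 // => /(_ isT).
  rewrite a00 mulr0 add0r invf_div mulrAC ler_pdivlMr //; nra.
have ap : 0 < a by rewrite lt_def an0.
have := h (D / a); rewrite divr_gt0 // => /(_ isT).
rewrite divfK // invf_div (_ : a / D * b = a * b / D); last by rewrite mulrAC.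
by rewrite mulr2n mulrDl mul1r lerD2l ler_pdivlMr // expr2.
Qed.

Section energy.
Context {R : realType} {k : field_kind} {X Y : hilbertType R k}.
Variables (j : {linear X -> Y}) (A : X -> X -> scalar_field R k) (s : R).
Local Notation mu := (@lebesgue_measure R).
Local Notation mR := (measurableTypeR R).

Lemma pullK (u : R -> Y) t : range j (u t) -> j (pull j u t) = u t.
Proof. by move=> [x _ xt]; apply: (@xgetPex _ 0 [set x | j x = u t]); exists x. Qed.

Lemma cvg_bounded_linear (C : R) {T : Type} (F : set_system T) {FF : Filter F}
    (f : T -> X) (x : X) : (forall x, nrm (j x) <= C * nrm x) ->
  f @ F --> x -> j (f t) @[t --> F] --> j x.
Proof.
move=> jC /cvg_nrmP fx; apply/cvg_nrmP => e e0.
have C1 : 0 < `|C| + 1 by rewrite ltr_wpDl.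
have d0 : 0 < e / (`|C| + 1) by rewrite divr_gt0.
apply: filterS (fx _ d0) => t; rewrite ltr_pdivlMr // -linearB; apply: le_lt_trans.
apply: le_trans (jC _) _; rewrite mulrC ler_wpM2l ?nrm_ge0 //.
by rewrite (le_trans (ler_norm _)) // lerDl.
Qed.

Lemma continuous_powR_within (a t : R) : 0 < a -> 0 <= t ->
  x `^ a @[x --> within [set x | 0 < x] (nbhs t)] --> t `^ a.
Proof.
move=> a0; rewrite le_eqVlt => /predU1P[<-|t0].
  by rewrite powR0 ?gt_eqF //; exact: powR_cvg0.
have : {for t, continuous (fun x : R => x `^ a)}; last exact: cvg_within_filter.
apply/differentiable_continuous/derivable1_diffP.
by apply: derivable_powR; rewrite in_itv /= t0.
Qed.

Lemma integral_powR (a r t : R) : 0 < a -> 0 < r -> r < t ->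
  (\int[mu]_(x in `[r, t]) (x `^ (a - 1))%:E = (a^-1 * (t `^ a - r `^ a))%:E)%E.
Proof.
move=> a0 r0 rt.
have dF (x : R) : 0 < x -> is_derive x 1 (fun x => a^-1 * x `^ a) (x `^ (a - 1)).
  move=> x0; have := is_deriveZ a^-1 (is_derive1_powR a x0).
  by rewrite /GRing.scale /= mulrA mulVf ?gt_eqF // mul1r.
rewrite (@continuous_FTC2 _ _ (fun x => a^-1 * x `^ a)) //.
- by rewrite -EFinB -mulrBr.
- apply: derivable_within_continuous => x; rewrite in_itv /= => /andP[rx _].
  by apply: derivable_powR; rewrite in_itv /= andbT (lt_le_trans r0).
- have c (x : R) : 0 < x -> {for x, continuous (fun x : R => a^-1 * x `^ a)}.
    by move=> x0; apply/differentiable_continuous/derivable1_diffP; have [] := dF x x0.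
  split=> [x||].
  + by rewrite in_itv /= => /andP[rx _]; have [] := dF x (lt_trans r0 rx).
  + by apply: cvg_at_right_filter; exact: c.
  + by apply: cvg_at_left_filter; apply: c; exact: lt_trans rt.
- move=> x; rewrite in_itv /= => /andP[rx _].
  by rewrite derive1E; have [_ ->] := dF x (lt_trans r0 rx).
Qed.

Hypotheses (jb : exists2 C : R, 0 <= C & forall x, nrm (j x) <= C * nrm x)
  (ellA : exists2 c : R, 0 < c & forall x : X, c * nrm x ^+ 2 <= re (A x x))
  (s01 : 0 < s < 1).

(** Strong measurability is assumed for the [X]-valued function [pull j u]; the bounded map [j]
    carries it, with local integrability, over to [u]. *)
Lemma Hspace_simple_limit (u : R -> Y) : Hspace j A s u ->
  exists u', [/\ simple_limit u',
    {ae mu, forall t, `]0, +oo[%classic t -> u t = u' t} &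
    forall a b, 0 < a -> mu.-integrable `[a, b] (EFin \o (fun t => nrm (u' t)))].
Proof.
move=> [_ [ju Lp] _ _]; have [C C0 jC] := jb.
have m0 : measurable (`]0, +oo[%classic : set mR) by exact: measurable_itv.
have [p lp up] := strongly_measurable_simple_limit m0 Lp.1.
have ip := L1loc_nrm_integrable Lp lp up.
have lj : simple_limit (j \o p).
  have [q sq qp] := lp; exists (fun n => j \o q n) => [n|t].
    exact: simple_comp.
  exact: cvg_bounded_linear jC (qp t).
exists (j \o p); split => //.
  apply: (@filterS2 _ _ (ae_filter_ringOfSetsType mu) _ _ _ _ ju up) => t jt pt t0.
  rewrite /= -pt // pullK //; apply: jt.
  by move: t0; rewrite /= in_itv /= andbT.
move=> a b a0; have mab : measurable (`[a, b]%classic : set mR) by exact: measurable_itv.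
apply: (@le_integrable _ _ _ mu _ mab _ (EFin \o (fun t => C * nrm (p t)))).
- apply/measurable_EFinP; apply: measurable_funTS.
  exact: simple_limit_nrm_measurable.
- by move=> t _; rewrite /= lee_fin !ger0_norm ?mulr_ge0 ?nrm_ge0.
- by have := integrableZl mab C (ip a b a0).
Qed.

Lemma re_A_ge0 x : 0 <= re (A x x).
Proof.
have [c c0 cA] := ellA; apply: le_trans (cA x).
by rewrite mulr_ge0 ?sqr_ge0 // ltW.
Qed.

Lemma energy_density (w : R -> Y) (p : R -> X) t :
  re (inner Y (w t) (w t) + A (p t) (p t)) = nrm (w t) ^+ 2 + re (A (p t) (p t)).
Proof. by rewrite reD -rip_nrm. Qed.

Lemma energy_fineK u : Hspace j A s u -> ((fine (energy j A s u))%:E = energy j A s u)%E.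
Proof.
move=> [_ _ _ Eoo]; rewrite fineK // ge0_fin_numE //.
apply: integral_ge0 => t _; rewrite lee_fin energy_density.
by rewrite mulr_ge0 ?powR_ge0 // addr_ge0 ?sqr_ge0 ?re_A_ge0.
Qed.

Lemma energy_ge0 u : 0 <= fine (energy j A s u).
Proof.
apply: fine_ge0; apply: integral_ge0 => t _; rewrite lee_fin energy_density.
by rewrite mulr_ge0 ?powR_ge0 // addr_ge0 ?sqr_ge0 ?re_A_ge0.
Qed.

(** Integrate [amgm_weighted] with P = x^(1-2s): the first term is controlled by the energy, and
    x^(2s-1) has the primitive x^(2s) / (2s). *)
Lemma integral_nrm_le_energy u v' r t l : Hspace j A s u -> simple_limit v' ->
  {ae mu, forall x, `]0, +oo[%classic x -> weak_derivative u x = v' x} ->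
  mu.-integrable `[r, t] (EFin \o (fun x => nrm (v' x))) ->
  0 < r -> r < t -> 0 < l ->
  2 * \int[mu]_(x in `[r, t]) nrm (v' x) <=
  l * fine (energy j A s u) + l^-1 * ((2 * s)^-1 * (t `^ (2 * s) - r `^ (2 * s))).
Proof.
move=> Hu lv' vv' iv' r0 rt l0; have /andP[s0 s1] := s01.
have s20 : 0 < 2 * s by rewrite mulr_gt0.
have mv D : measurable_fun (D : set mR) (fun x => nrm (v' x)).
  by apply: measurable_funTS; exact: simple_limit_nrm_measurable.
have mp q D : measurable_fun (D : set mR) (fun x : R => x `^ q).
  by apply: measurable_funTS; exact: measurable_powR.
have mrt : measurable (`[r, t]%classic : set mR) by exact: measurable_itv.
have m0 : measurable (`]0, +oo[%classic : set mR) by exact: measurable_itv.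
have mf D : measurable_fun (D : set mR) (fun x => (nrm (v' x) ^+ 2 * x `^ (1 - 2 * s))%:E).
  apply/measurable_EFinP; apply: measurable_funM => //.
  exact: measurable_funX.
have mg D : measurable_fun (D : set mR) (fun x : R => (x `^ (2 * s - 1))%:E).
  by apply/measurable_EFinP.
(* The part of the energy carried by [A] is dropped. The energy density need not be measurable, so
   the comparison goes through the lower integral. *)
have h1 : (\int[mu]_(x in `[r, t]) (nrm (v' x) ^+ 2 * x `^ (1 - 2 * s))%:E
    <= energy j A s u)%E.
  apply: (@le_trans _ _ (\int[mu]_(x in `]0%R, +oo[)
      (nrm (v' x) ^+ 2 * x `^ (1 - 2 * s))%:E)%E).
    apply: ge0_subset_integral => //.
      by move=> x _; rewrite lee_fin mulr_ge0 ?powR_ge0 ?sqr_ge0.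
    by move=> x; rewrite /= !in_itv /= andbT => /andP[rx _]; exact: lt_le_trans rx.
  apply: ae_le_integral_lower => //.
  - by move=> x _; rewrite lee_fin mulr_ge0 ?powR_ge0 ?sqr_ge0.
  - move=> x _; rewrite lee_fin energy_density.
    by rewrite mulr_ge0 ?powR_ge0 // addr_ge0 ?sqr_ge0 ?re_A_ge0.
  apply: (@filterS _ _ (ae_filter_ringOfSetsType mu) _ _ _ vv') => x vx x0.
  rewrite lee_fin energy_density vx // ler_wpM2r ?powR_ge0 //.
  by rewrite lerDl re_A_ge0.
rewrite -lee_fin -RintegralZl // /Rintegral fineK; last first.
  by apply: integrable_fin_num => //; have := integrableZl mrt 2 iv'.
apply: (@le_trans _ _ (\int[mu]_(x in `[r, t])
    (l%:E * (nrm (v' x) ^+ 2 * x `^ (1 - 2 * s))%:E + l^-1%:E * (x `^ (2 * s - 1))%:E))%E).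
  apply: ge0_le_integral => //.
  - by move=> x _; rewrite lee_fin mulr_ge0 ?nrm_ge0.
  - by apply/measurable_EFinP; exact: measurable_funM.
  - apply: emeasurable_funD; exact: emeasurable_funM.
  move=> x; rewrite /= in_itv /= => /andP[rx _].
  rewrite -!EFinM -EFinD lee_fin -[2 * s - 1]opprB powRN.
  by apply: amgm_weighted => //; rewrite powR_gt0 // (lt_le_trans r0).
rewrite ge0_integralD //; last 4 first.
- move=> x _; rewrite -EFinM lee_fin; apply: mulr_ge0; first exact: ltW.
  by rewrite mulr_ge0 ?powR_ge0 ?sqr_ge0.
- exact: emeasurable_funM.
- move=> x _; rewrite -EFinM lee_fin; apply: mulr_ge0; last exact: powR_ge0.
  by rewrite invr_ge0 ltW.
- exact: emeasurable_funM.
rewrite !ge0_integralZl_EFin // ?invr_ge0 ?(ltW l0) //; last 2 first.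
- by move=> x _; rewrite lee_fin powR_ge0.
- by move=> x _; rewrite lee_fin mulr_ge0 ?powR_ge0 ?sqr_ge0.
rewrite integral_powR // EFinD; apply: leeD.
  by rewrite EFinM energy_fineK //; apply: lee_wpmul2l => //; rewrite lee_fin ltW.
by rewrite EFinM.
Qed.

(** Bound the increment by the integral of the norm of the derivative, then optimise over l by
    [sqr_le_of_amgm]. *)
Lemma Hspace_hoelder u : Hspace j A s u -> exists G : set R,
  {ae mu, forall t, 0 < t -> G t} /\
  forall r t, 0 < r -> 0 < t -> G r -> G t ->
    nrm (u r - u t) ^+ 2 <=
    (fine (energy j A s u) / (2 * s)) * `|r `^ (2 * s) - t `^ (2 * s)|.
Proof.
move=> Hu; have /andP[s0 s1] := s01.
have [u' [lu' uu' iu']] := Hspace_simple_limit Hu.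
have wd : is_weak_derivative u (weak_derivative u).
  have [_ _ [v uv] _] := Hu.
  by apply: (@xgetPex _ (fun=> 0) [set v | is_weak_derivative u v]); exists v.
have [v' [G [lv' vv' iv' aeG uG]]] := weak_derivative_dist lu' uu' iu' wd.
exists G; split.
  apply: (@filterS _ _ (ae_filter_ringOfSetsType mu) _ _ _ aeG) => t Gt t0.
  by apply: Gt; rewrite /= in_itv /= t0.
have key r t : 0 < r -> r < t -> G r -> G t -> nrm (u r - u t) ^+ 2 <=
    (fine (energy j A s u) / (2 * s)) * `|r `^ (2 * s) - t `^ (2 * s)|.
  move=> r0 rt Gr Gt.
  have prt : r `^ (2 * s) <= t `^ (2 * s).
    by apply: ge0_ler_powR; rewrite ?nnegrE ?mulr_ge0 ?ltW // (lt_trans r0).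
  rewrite distrC ger0_norm ?subr_ge0 // -mulrA nrm_distC.
  apply: sqr_le_of_amgm; first exact: nrm_ge0.
  - exact: energy_ge0.
  - by rewrite mulr_ge0 ?invr_ge0 ?mulr_ge0 ?subr_ge0 // ltW.
  move=> l l0; apply: le_trans (integral_nrm_le_energy Hu lv' vv' (iv' r t r0) r0 rt l0).
  by rewrite ler_wpM2l // uG.
move=> r t r0 t0 Gr Gt; have [rt|tr|->] := ltgtP r t.
- exact: key.
- by rewrite nrm_distC distrC; exact: key.
- by rewrite !subrr nrm0 expr0n normr0 mulr0.
Qed.

(** Extend [u] to the closed half-line by [hoelder_extension] with modulus t^(2s). The value at 0 is
    the trace, and the estimate is the case r = 0. *)
Lemma Hspace_trace u : Hspace j A s u -> exists y, is_trace u y /\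
  exists G : set R, {ae mu, forall t, 0 < t -> G t} /\
  forall t, 0 < t -> G t ->
    nrm (y - u t) ^+ 2 <= (fine (energy j A s u) / (2 * s)) * t `^ (2 * s).
Proof.
move=> Hu; have /andP[s0 s1] := s01; have s20 : 0 < 2 * s by rewrite mulr_gt0.
have [G [aeG uG]] := Hspace_hoelder Hu.
have C0 : 0 <= fine (energy j A s u) / (2 * s) by rewrite divr_ge0 ?energy_ge0 // ltW.
have [w [wu wh]] := hoelder_extension (tau := fun t => t `^ (2 * s)) C0 aeG uG
  (fun t => continuous_powR_within s20).
have cw (t : R) : 0 <= t -> w x @[x --> within [set x | 0 < x] (nbhs t)] --> w t.
  move=> t0; apply/cvg_nrmP => e e0.
  set C := fine _ / _ in C0 wh.
  have C1 : 0 < C + 1 by rewrite ltr_wpDl.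
  have d0 : 0 < e ^+ 2 / (C + 1) by rewrite divr_gt0 ?exprn_gt0.
  have /cvgrPdist_lt/(_ _ d0) := continuous_powR_within s20 t0.
  apply: (@filterS _ (nbhs t)) => x h x0; have {}h := h x0.
  rewrite -(@ltr_pXn2r _ 2) ?nnegrE ?nrm_ge0 ?ltW //.
  apply: le_lt_trans (wh _ _ t0 (ltW x0)) _.
  move: h; rewrite ltr_pdivlMr // => h; apply: le_lt_trans h.
  by rewrite mulrC ler_wpM2l // lerDl.
exists (w 0); split.
  exists w; split.
  - apply: (@filterS _ _ (ae_filter_ringOfSetsType mu) _ _ _ aeG) => t Gt t0.
    by rewrite wu //; exact: Gt.
  - move=> t; rewrite in_itv /= andbT => t0.
    move=> B /(cw t (ltW t0)) h; have t0n := lt_nbhsr t0.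
    by apply: (@filterS2 _ (nbhs t) _ _ _ _ _ h t0n) => x hx; exact: hx.
  - exact: cw.
exists G; split => // t t0 Gt; rewrite -wu //.
apply: le_trans (wh _ _ _ _) _ => //; first exact: ltW.
by rewrite powR0 ?gt_eqF // sub0r normrN ger0_norm ?powR_ge0.
Qed.

(** If no such t existed, the norm of [pull j u] would be large at almost every point of (e/2, e),
    and by ellipticity the energy would exceed its own value. *)
Lemma Hspace_pull_small u (P : set R) (e : R) : Hspace j A s u ->
  {ae mu, forall t, 0 < t -> P t} -> 0 < e -> e <= 1 ->
  forall c, 0 < c -> (forall x : X, c * nrm x ^+ 2 <= re (A x x)) ->
  exists t, [/\ 0 < t, t < e, P t, j (pull j u t) = u t &
    nrm (pull j u t) ^+ 2 <= (fine (energy j A s u) + 1) / (c * (e / 2) ^+ 2)].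
Proof.
move=> Hu aeP e0 e1 c c0 cA; have /andP[s0 s1] := s01.
apply: contrapT => no.
set E := fine (energy j A s u) in no.
have [_ [ju _] _ _] := Hu.
pose I := `](e / 2), e[%classic : set R.
have mI : measurable (I : set mR) by exact: measurable_itv.
have e2 : 0 < e / 2 by rewrite divr_gt0.
have muI : mu I = (e / 2)%:E.
  rewrite lebesgue_measure_itv /= lte_fin ltr_pdivrMr // ltr_pMr // ltr1n.
  by rewrite -EFinB; congr (_%:E); field.
have E0 : 0 <= E by exact: energy_ge0.
(* Chosen so that c K (e/2) (e/2) = E + 1: one factor e/2 bounds the weight from below, the other is
   the length of the interval. *)
pose K := (E + 1) / (c * (e / 2) ^+ 2).
have K0 : 0 <= K by rewrite divr_ge0 ?addr_ge0 // mulr_ge0 ?sqr_ge0 // ltW.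
pose f := (cst (c * K * (e / 2))%:E : R -> \bar R) \_ I.
have m0 : measurable (`]0, +oo[%classic : set mR) by exact: measurable_itv.
have h : (\int[mu]_(t in `]0%R, +oo[) f t <= energy j A s u)%E.
  apply: ae_le_integral_lower => //.
  - by apply: measurable_funTS; apply/(measurable_restrictT _ _).1.
  - move=> t _; rewrite /f /patch; case: ifP => // _.
    by rewrite /= lee_fin (mulr_ge0 (mulr_ge0 (ltW c0) K0) (ltW e2)).
  - move=> t _; rewrite lee_fin energy_density.
    by rewrite mulr_ge0 ?powR_ge0 // addr_ge0 ?sqr_ge0 ?re_A_ge0.
  apply: (@filterS2 _ _ (ae_filter_ringOfSetsType mu) _ _ _ _ ju aeP) => t jt Pt.
  rewrite /= in_itv /= andbT => t0.
  have h0 : 0 <= re (inner Y (weak_derivative u t) (weak_derivative u t) +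
      A (pull j u t) (pull j u t)) * t `^ (1 - 2 * s).
    by rewrite energy_density mulr_ge0 ?powR_ge0 // addr_ge0 ?sqr_ge0 ?re_A_ge0.
  rewrite /f /patch; case: ifPn => [|_]; last by rewrite lee_fin.
  rewrite inE /I /= in_itv /= => /andP[et te].
  rewrite lee_fin energy_density.
  have Kp : K < nrm (pull j u t) ^+ 2.
    rewrite ltNge; apply/negP => nK; apply: no; exists t; split => //.
    - exact: Pt.
    - by apply: pullK; exact: jt.
  apply: ler_pM (mulr_ge0 (ltW c0) K0) (ltW e2) _ _.
    apply: le_trans (_ : re (A (pull j u t) (pull j u t)) <= _); last by rewrite lerDr sqr_ge0.
    by apply: le_trans (cA _); rewrite ler_wpM2l ?ltW.
  apply: le_trans (ltW et) _.
  have t01 : 0 < t <= 1 by rewrite t0 (le_trans (ltW te)).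
  (* As t <= 1 and 1 - 2s <= 1, the weight t^(1-2s) is at least t, whatever the sign of 1 - 2s. *)
  rewrite -[leLHS](powRr1 (ltW t0)); apply: ger_powR => //.
  by rewrite gerBl mulr_ge0 // ltW.
have : ((c * K * (e / 2) * (e / 2))%:E <= energy j A s u)%E.
  apply: le_trans h.
  rewrite -integral_mkcondr (_ : `]0, +oo[ `&` I = I); last first.
    by apply/setIidr => t; rewrite /I /= !in_itv /= andbT => /andP[et _]; exact: lt_trans et.
  by rewrite integral_cst // [X in (_ <= _ * X)%E]muI -EFinM.
rewrite -energy_fineK // lee_fin -/E.
have -> : c * K * (e / 2) * (e / 2) = E + 1.
  by rewrite /K; field; rewrite !gt_eqF.
by rewrite leNgt ltrDl ltr01.
Qed.

End energy.

(** * Linearity and compactness of the trace operator *)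

Section trace_operator.
Context {R : realType} {k : field_kind}.
Local Notation mu := (@lebesgue_measure R).

Lemma is_trace_traceE {V : normedModType (scalar_field R k)} (u : R -> V) y :
  is_trace u y -> trace u = y.
Proof.
move=> uy; apply: (is_trace_unique (u := u)) => //.
by apply: (@xgetPex _ 0 [set y | is_trace u y]); exists y.
Qed.

Lemma is_trace_lin {V : normedModType (scalar_field R k)} (a : scalar_field R k)
    (u v : R -> V) y z : is_trace u y -> is_trace v z ->
  is_trace (a *: u + v) (a *: y + z).
Proof.
move=> [u' [uu' cu uy]] [v' [vv' cv vz]]; exists (a *: u' + v'); split.
- apply: (@filterS2 _ _ (ae_filter_ringOfSetsType mu) _ _ _ _ uu' vv') => t ut vt t0.
  by rewrite !fctE ut // vt.
- move=> t t0; apply: cvgD; last exact: cv.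
  by apply: cvgZ; [exact: cvg_cst|exact: cu].
- by apply: cvgD => //; apply: cvgZ => //; exact: cvg_cst.
Qed.

End trace_operator.

Theorem theorem1 (R : realType) (k : field_kind) (X Y : hilbertType R k)
    (j : {linear X -> Y}) (A : {linear X -> (X -> (scalar_field R k)^o)}) (s : R) :
  injective j ->
  compact_operator setT (@nrm R k X) j ->
  dense (range j) ->
  (forall u : X, dual_space (A u)) ->
  dual_continuous A ->
  symmetric_operator A ->
  elliptic A ->
  0 < s < 1 ->
  (forall u : R -> Y, Hspace j A s u -> exists! y : Y, is_trace u y) /\
  compact_operator (Hspace j A s) (Hnorm j A s) (@trace R k Y).
Proof.
move=> _ cj _ _ _ _ [c c0 cA] s01.
have jb := compact_operator_bounded cj.
have cA' (x : X) : c * nrm x ^+ 2 <= re (A x x).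
  by have := le_re (cA x); rewrite re_of_realM re_sqr.
have ellA : exists2 c : R, 0 < c & forall x : X, c * nrm x ^+ 2 <= re (A x x).
  by exists c.
have tr u := Hspace_trace jb ellA s01 (u := u).
have /andP[s0 s1] := s01; have s20 : 0 < 2 * s by rewrite mulr_gt0.
split=> [u /tr[y [uy _]]|].
  by exists y; split => // z; exact: is_trace_unique.
split=> [a u v /tr[y [uy _]] /tr[z [vz _]]|B BH [M0 BM]].
  rewrite (is_trace_traceE (is_trace_lin a uy vz)).
  by rewrite (is_trace_traceE uy) (is_trace_traceE vz).
have E_ge0 u : 0 <= fine (energy j A s u) by apply: energy_ge0; exact: ellA.
(* The given bound may be negative when [B] is empty; squaring needs a nonnegative one. *)
pose M := Num.max M0 0.
have M_ge0 : 0 <= M by rewrite le_max lexx orbT.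
have EM u : B u -> fine (energy j A s u) <= M ^+ 2.
  move=> Bu; rewrite -[leLHS]sqr_sqrtr ?E_ge0 //.
  by rewrite lerXn2r ?nnegrE ?sqrtr_ge0 // le_max (BM _ Bu).
apply: compact_closure_approx => d d0.
(* Since e^(2s) tends to 0 with e, the trace error at times below e is smaller than d, uniformly
   over [B]. *)
have [e [e0 e1 ed]] : exists e,
    [/\ 0 < e, e <= 1 & (M ^+ 2 + 1) / (2 * s) * e `^ (2 * s) < d ^+ 2].
  have C0 : 0 < (M ^+ 2 + 1) / (2 * s) by rewrite divr_gt0 // ltr_wpDl ?sqr_ge0.
  have d1 : 0 < d ^+ 2 / ((M ^+ 2 + 1) / (2 * s)) by rewrite divr_gt0 ?exprn_gt0.
  have /cvgrPdist_lt/(_ _ d1) small := powR_cvg0 s20.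
  near (0 : R)^'+ => e; exists e; split => //.
    by near: e; exact: nbhs_right_le.
  rewrite mulrC -ltr_pdivlMr //; apply: le_lt_trans (ler_norm _) _.
  by rewrite -normrN -sub0r; near: e.
pose L := (M ^+ 2 + 1) / (c * (e / 2) ^+ 2).
exists (closure (j @` [set x | nrm x ^+ 2 <= L])).
  (* The bound L + 1 on the norm avoids a square root: 2 |x| <= |x|^2 + 1. *)
  apply: cj.2 => //; exists (L + 1) => x /= xL.
  by have := sqr_ge0 (nrm x - 1); have := nrm_ge0 x; nra.
move=> _ [u Bu <-].
have Hu := BH u Bu; have [y [uy [G [aeG uG]]]] := tr u Hu.
(* The time t depends on u, but the bound [L] on the [X]-norm does not, so one compact set serves
   the whole of [B]. *)
have [t [t0 te Gt jt tL]] := Hspace_pull_small ellA s01 Hu aeG e0 e1 c0 cA'.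
exists (u t).
  apply: subset_closure; exists (pull j u t) => //=; apply: le_trans tL _.
  apply: ler_wpM2r; last by rewrite lerD2r EM.
  by rewrite invr_ge0 mulr_ge0 ?sqr_ge0 ?(ltW c0).
rewrite (is_trace_traceE uy) -(@ltr_pXn2r _ 2) ?nnegrE ?nrm_ge0 ?ltW //.
apply: le_lt_trans (uG t t0 Gt) _; apply: le_lt_trans ed.
apply: ler_pM; rewrite ?powR_ge0 ?divr_ge0 ?E_ge0 ?(ltW s20) //.
  rewrite ler_wpM2r ?invr_ge0 ?(ltW s20) //.
  by apply: le_trans (EM _ Bu) _; rewrite lerDl.
by apply: ge0_ler_powR; rewrite ?nnegrE ?(ltW s20) ?(ltW t0) ?(ltW e0) ?(ltW te).
Unshelve. all: by end_near. Qed.
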